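(* Let $p$ be a prime, $n$ a positive integer which is a multiple of $p-1$, $u\in\mathbb{Z}_p^\times$, and $F_0$ an abelian finite subgroup of $\mathbb{S}_n$. Let $r_1$ be a divisor of the ramification index $e(\mathbb{Q}_p(F_0))$ of $\mathbb{Q}_p(F_0)$ over $\mathbb{Q}_p$. 1. The set $\widetilde{\mathcal{F}}_u(\mathbb{Q}_p(F_0)^\times,\widetilde{F_0},r_1)$ is non-empty if and only if the class $e_u(F_0,r_1)$ becomes trivial in $H^2(\mathbb{Z}/r_1,\mathbb{Z}_p(F_0)^\times/F_0)$. 2. If $\widetilde{\mathcal{F}}_u(\mathbb{Q}_p(F_0)^\times,\widetilde{F_0},r_1)$ is non-empty and if $\widetilde{F_1}=\langle\widetilde{F_0},x_1\rangle$ belongs to this set with $v(x_1)=\frac1{r_1}$, then there is a bijection $$\psi_1:H^1(\mathbb{Z}/r_1,\mathbb{Z}_p(F_0)^\times/F_0)\longrightarrow\widetilde{\mathcal{F}}_u(\mathbb{Q}_p(F_0)^\times,\widetilde{F_0},r_1),\qquad y\longmapsto\langle\widetilde{F_0},y x_1\rangle .$$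
   Context: $\mathbb{D}_n$ is the central division algebra over $\mathbb{Q}_p$ of Hasse invariant $1/n$, $\mathcal{O}_n$ its maximal order, $\mathbb{S}_n=\mathcal{O}_n^\times$; $v$ is the valuation on $\mathbb{D}_n$ with $v(p)=1$, so $v(\mathbb{D}_n^\times)=\frac1n\mathbb{Z}$. $\mathbb{Q}_p(F_0)$ and $\mathbb{Z}_p(F_0)$ are the $\mathbb{Q}_p$- and $\mathbb{Z}_p$-subalgebras of $\mathbb{D}_n$ generated by $F_0$ (a cyclotomic field and its ring of integers), and $\widetilde{F_0}=F_0\times\langle pu\rangle$. $\widetilde{\mathcal{F}}_u(\mathbb{Q}_p(F_0)^\times,\widetilde{F_0},r_1)$ is the set of subgroups $\widetilde{F_1}$ of $\mathbb{Q}_p(F_0)^\times$ containing $\widetilde{F_0}$ as a subgroup of finite index, such that $v$ induces an injection $\widetilde{F_1}/\widetilde{F_0}\hookrightarrow\frac1n\mathbb{Z}/\mathbb{Z}$ and $|\widetilde{F_1}/\widetilde{F_0}|=r_1$. $e_u(F_0)\in H^2(\mathbb{Z}/e(\mathbb{Q}_p(F_0)),\mathbb{Z}_p(F_0)^\times\times\langle pu\rangle)$ is the class of the extension $1\to\mathbb{Z}_p(F_0)^\times\times\langle pu\rangle\to\mathbb{Q}_p(F_0)^\times\to\frac{1}{e(\mathbb{Q}_p(F_0))}\mathbb{Z}/\mathbb{Z}\to1$ given by $v$, and $e_u(F_0,r_1)\in H^2(\mathbb{Z}/r_1,\mathbb{Z}_p(F_0)^\times\times\langle pu\rangle)$ is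 its restriction to the subgroup $\frac1{r_1}\mathbb{Z}/\mathbb{Z}\cong\mathbb{Z}/r_1$ of $\frac{1}{e(\mathbb{Q}_p(F_0))}\mathbb{Z}/\mathbb{Z}$. ''Becomes trivial'' refers to its image under the map induced by the quotient $\mathbb{Z}_p(F_0)^\times\times\langle pu\rangle\to(\mathbb{Z}_p(F_0)^\times\times\langle pu\rangle)/\widetilde{F_0}=\mathbb{Z}_p(F_0)^\times/F_0$. All actions are trivial, so a class in $H^1(\mathbb{Z}/r_1,\mathbb{Z}_p(F_0)^\times/F_0)=\mathrm{Hom}(\mathbb{Z}/r_1,\mathbb{Z}_p(F_0)^\times/F_0)$ is identified with the image $y$ of the generator $1$ (corresponding to $\frac{1}{r_1}$), and $\langle\widetilde{F_0},yx_1\rangle$ is formed with any representative of $y$ in $\mathbb{Z}_p(F_0)^\times$. *)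

(* Defs.v *)
From HB Require Import structures.
From mathcomp Require Import all_boot all_order all_algebra all_field.
From mathcomp Require Import finmap boolp classical_sets functions cardinality.

Set Implicit Arguments.
Unset Strict Implicit.
Unset Printing Implicit Defensive.

Import Order.TTheory GRing.Theory Num.Theory.

Local Open Scope classical_set_scope.
Local Open Scope ring_scope.
Local Open Scope quotient_scope.

Lemma modz_mul_modl (m : int) (d q : nat) :
  ((m %% (d * q)%N)%Z %% d)%Z = (m %% d)%Z.
Proof.
rewrite {2}(divz_eq m (d * q)%N) PoszM (mulrC d%:Z) mulrA.
by rewrite modzMDl.
Qed.

(* The p-adic integers, as the inverse limit of the rings Z/p^i: a p-adic
   integer is the sequence of its canonical residues modulo p^i. *)
Section PadicIntegers.

Variable p : nat.

Record padic_seq := PadicInt {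
  residue :> nat -> int;
  _ : forall i, residue i = (residue i.+1 %% (p ^ i)%N)%Z }.

Implicit Types x y z : padic_seq.

Lemma residueP x i : x i = (x i.+1 %% (p ^ i)%N)%Z.
Proof. by case: x. Qed.

Lemma padic_int_inj x y : residue x = residue y -> x = y.
Proof.
case: x y => [f Pf] [g Pg] /= efg; case: _ / efg in Pg *.
by rewrite (Prop_irrelevance Pf Pg).
Qed.

Lemma residue_mod x i : (x i %% (p ^ i)%N)%Z = x i.
Proof. by rewrite residueP modz_mod. Qed.

Definition of_coherent (f : nat -> int) i := (f i %% (p ^ i)%N)%Z.

Lemma of_coherentP (f : nat -> int) :
  (forall i, f i.+1 = f i %[mod (p ^ i)%N])%Z ->
  forall i, of_coherent f i = (of_coherent f i.+1 %% (p ^ i)%N)%Z.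
Proof. by move=> fP i; rewrite /of_coherent expnSr modz_mul_modl fP. Qed.

Lemma residueS x i : (x i.+1 = x i %[mod (p ^ i)%N])%Z.
Proof. by rewrite -residueP residue_mod. Qed.

Lemma add_coherent x y i :
  ((x i.+1 + y i.+1) = (x i + y i) %[mod (p ^ i)%N])%Z.
Proof. by rewrite -modzDm !residueS modzDm. Qed.

Lemma opp_coherent x i : (- x i.+1 = - x i %[mod (p ^ i)%N])%Z.
Proof. by rewrite -modzNm residueS modzNm. Qed.

Lemma mul_coherent x y i :
  ((x i.+1 * y i.+1) = (x i * y i) %[mod (p ^ i)%N])%Z.
Proof. by rewrite -modzMm !residueS modzMm. Qed.

Definition padic0 := PadicInt (of_coherentP (fun i : nat => erefl (0 %% (p ^ i)%N)%Z)).
Definition padic1 := PadicInt (of_coherentP (fun i : nat => erefl (1 %% (p ^ i)%N)%Z)).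
Definition padic_add x y := PadicInt (of_coherentP (add_coherent x y)).
Definition padic_opp x := PadicInt (of_coherentP (opp_coherent x)).
Definition padic_mul x y := PadicInt (of_coherentP (mul_coherent x y)).

Lemma padic_addA : associative padic_add.
Proof.
move=> x y z; apply/padic_int_inj/funext => i.
by rewrite /= /of_coherent modzDml modzDmr addrA.
Qed.

Lemma padic_addC : commutative padic_add.
Proof.
by move=> x y; apply/padic_int_inj/funext => i; rewrite /= /of_coherent addrC.
Qed.

Lemma padic_add0 : left_id padic0 padic_add.
Proof.
move=> x; apply/padic_int_inj/funext => i.
by rewrite /= /of_coherent mod0z add0r residue_mod.
Qed.

Lemma padic_addN : left_inverse padic0 padic_opp padic_add.
Proof.
move=> x; apply/padic_int_inj/funext => i.
by rewrite /= /of_coherent modzDml addNr.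
Qed.

Lemma padic_mulA : associative padic_mul.
Proof.
move=> x y z; apply/padic_int_inj/funext => i.
by rewrite /= /of_coherent modzMml modzMmr mulrA.
Qed.

Lemma padic_mulC : commutative padic_mul.
Proof.
by move=> x y; apply/padic_int_inj/funext => i; rewrite /= /of_coherent mulrC.
Qed.

Lemma padic_mul1 : left_id padic1 padic_mul.
Proof.
move=> x; apply/padic_int_inj/funext => i.
by rewrite /= /of_coherent modzMml mul1r residue_mod.
Qed.

Lemma padic_mulDl : left_distributive padic_mul padic_add.
Proof.
move=> x y z; apply/padic_int_inj/funext => i.
by rewrite /= /of_coherent modzMml modzDm mulrDl.
Qed.

(* The ring structure below depends on the proof that p is prime. *)
Definition padic_int of prime p : Type := padic_seq.

Variable p_pr : prime p.

Lemma padic1_neq0 : padic1 <> padic0.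
Proof.
move=> /(congr1 (fun x : padic_seq => x 1%N)); rewrite /= /of_coherent expn1.
by rewrite mod0z modz_small // ltz_nat prime_gt1.
Qed.

HB.instance Definition _ := gen_eqMixin (padic_int p_pr).
HB.instance Definition _ := gen_choiceMixin (padic_int p_pr).
HB.instance Definition _ := GRing.isZmodule.Build (padic_int p_pr)
  padic_addA padic_addC padic_add0 padic_addN.

Lemma padic_oner_neq0 : padic1 != 0 :> padic_int p_pr.
Proof. exact/eqP/padic1_neq0. Qed.

HB.instance Definition _ := GRing.Zmodule_isComNzRing.Build (padic_int p_pr)
  padic_mulA padic_mulC padic_mul1 padic_mulDl padic_oner_neq0.

Definition padic_unit : pred (padic_int p_pr) :=
  fun x => `[< exists y : padic_int p_pr, y * x = 1 >].
Definition padic_inv (x : padic_int p_pr) : padic_int p_pr :=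
  if pselect (exists y : padic_int p_pr, y * x = 1) is left ex then projT1 (cid ex) else x.

Lemma padic_mulVx : {in padic_unit, left_inverse 1 padic_inv *%R}.
Proof.
move=> x /asboolP ex; rewrite /padic_inv.
by case: pselect => // ex'; case: cid.
Qed.

Lemma padic_unitPl (x y : padic_int p_pr) : y * x = 1 -> padic_unit x.
Proof. by move=> yx1; apply/asboolP; exists y. Qed.

Lemma padic_inv_out : {in [predC padic_unit], padic_inv =1 id}.
Proof. by move=> x /asboolP nex; rewrite /padic_inv; case: pselect. Qed.

HB.instance Definition _ := GRing.ComNzRing_hasMulInverse.Build (padic_int p_pr)
  padic_mulVx padic_unitPl padic_inv_out.

Lemma residueD x i k : x i = (x (i + k)%N %% (p ^ i)%N)%Z.
Proof.
elim: k => [|k IH]; first by rewrite addn0 residue_mod.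
by rewrite IH addnS (residueP x (i + k)) expnD modz_mul_modl.
Qed.

Lemma residue_neq0 (x : padic_int p_pr) : x != 0 -> exists i, x i != 0.
Proof.
move=> /eqP x0; apply: contrapT => nex.
apply/x0/padic_int_inj/funext => i; rewrite /= /of_coherent mod0z.
by apply/eqP; apply: contrapT => /negP xi; apply: nex; exists i.
Qed.

Lemma ndvdn_expD (i j a b : nat) :
  ~~ (p ^ i %| a)%N -> ~~ (p ^ j %| b)%N -> ~~ (p ^ (i + j) %| a * b)%N.
Proof.
have [->|a0] := posnP a; first by rewrite dvdn0.
have [->|b0] := posnP b; first by rewrite dvdn0.
rewrite !pfactor_dvdn ?muln_gt0 ?a0 ?b0 // lognM // -!ltnNge => ai bj.
by rewrite -addSn leq_add // ltnW.
Qed.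

Lemma padic_mulf_eq0 (x y : padic_int p_pr) : x * y = 0 -> (x == 0) || (y == 0).
Proof.
move=> xy0; apply/norP => -[/residue_neq0[i xi] /residue_neq0[j yj]].
have /eqP := congr1 (fun z : padic_seq => z (i + j)%N) xy0.
rewrite /= /of_coherent mod0z => /eqP/dvdz_mod0P; apply/negP.
rewrite dvdzE abszM; apply: ndvdn_expD.
  by apply: contra xi => xi; rewrite (residueD x i j); exact/eqP/dvdz_mod0P.
by apply: contra yj => yj; rewrite (residueD y j i) addnC; exact/eqP/dvdz_mod0P.
Qed.

HB.instance Definition _ :=
  GRing.ComUnitRing_isIntegral.Build (padic_int p_pr) padic_mulf_eq0.

Definition padic := {fraction padic_int p_pr}.
HB.instance Definition _ := GRing.Field.on padic.

Definition Zp_to_Qp (a : padic_int p_pr) : padic := tofrac a.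

Lemma residue_nat m i : (m%:R : padic_int p_pr) i = (m%:Z %% (p ^ i)%N)%Z.
Proof.
elim: m => [|m IH]; first by rewrite /= /of_coherent.
rewrite -addn1 natrD /= {1}/of_coherent IH /= /of_coherent.
by rewrite modzDml modzDmr.
Qed.

Lemma padic_p_neq0 : (p%:R : padic_int p_pr) != 0.
Proof.
apply/eqP => /(congr1 (fun x : padic_seq => x 2)); rewrite residue_nat /=.
rewrite /of_coherent mod0z modz_small; last first.
  by rewrite lez_nat ltz_nat -[X in (X < _)%N]expn1 ltn_exp2l // prime_gt1.
by move=> [p0]; move: p_pr; rewrite p0.
Qed.

End PadicIntegers.

(* Cohomology ker d' / im d of a complex A -d-> B -d'-> C of abelian groups. *)
Section Complex.

Variables (A B C : zmodType) (d : {additive A -> B}) (d' : {additive B -> C}).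

Definition cocycle_pred : {pred B} := fun x => d' x == 0.

Lemma cocycle_pred_zmod : zmod_closed cocycle_pred.
Proof.
split=> [|x y]; rewrite !unfold_in ?raddf0 // raddfB => /eqP-> /eqP->.
by rewrite subrr.
Qed.

HB.instance Definition _ :=
  GRing.isZmodClosed.Build B cocycle_pred cocycle_pred_zmod.

Record cocycle := Cocycle { cochain :> B; _ : cochain \in cocycle_pred }.

HB.instance Definition _ := [isSub for cochain].
HB.instance Definition _ := [Choice of cocycle by <:].
HB.instance Definition _ := [SubChoice_isSubZmodule of cocycle by <:].

Definition coboundary : {pred cocycle} :=
  fun z => `[< exists a, d a = cochain z >].

Lemma coboundary_zmod : zmod_closed coboundary.
Proof.
split=> [|x y /asboolP[a ax] /asboolP[b by_]]; apply/asboolP.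
  by exists 0; rewrite !raddf0.
by exists (a - b); rewrite raddfB ax by_.
Qed.

HB.instance Definition _ :=
  GRing.isZmodClosed.Build cocycle coboundary coboundary_zmod.

Definition cohomology := Quotient.quot coboundary.
HB.instance Definition _ := GRing.Zmodule.on cohomology.

Definition coh_class (z : cocycle) : cohomology := \pi_(Quotient.quot coboundary) z.

End Complex.

(* H^1 and H^2 of a finite abelian group G with coefficients in an abelian
   group A on which G acts trivially, by inhomogeneous cochains. *)
Section GroupCohomology.

Variables (G : finZmodType) (A : zmodType).

(* (d0 a)(g) = g.a - a *)
Definition delta0 (a : A) : {ffun G -> A} := [ffun=> a - a].
Definition delta1 (f : {ffun G -> A}) : {ffun G * G -> A} :=
  [ffun x : G * G => let: (g, h) := x in f h - f (g + h) + f g].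
Definition delta2 (f : {ffun G * G -> A}) : {ffun G * G * G -> A} :=
  [ffun x : G * G * G => let: (g, h, k) := x in
    f (h, k) - f (g + h, k) + f (g, h + k) - f (g, h)].

Lemma addrDBA (a b c d : A) : (a - b) + (c - d) = (a + c) - (b + d).
Proof. by rewrite addrACA opprD. Qed.

Lemma addrBBA (a b c d : A) : (a - b) - (c - d) = (a - c) - (b - d).
Proof. by rewrite !opprB addrACA [RHS]addrACA (addrC (- b)). Qed.

Lemma delta0_additive : zmod_morphism delta0.
Proof. by move=> a b; apply/ffunP => g; rewrite !ffunE !subrr. Qed.

Lemma delta1_additive : zmod_morphism delta1.
Proof.
move=> a b; apply/ffunP => -[g h]; rewrite !ffunE.
by rewrite [X in X + _ = _]addrBBA [LHS]addrDBA.
Qed.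

Lemma delta2_additive : zmod_morphism delta2.
Proof.
move=> a b; apply/ffunP => -[[g h] k]; rewrite !ffunE.
by rewrite [X in X + _ - _ = _]addrBBA [X in X - _ = _]addrDBA [LHS]addrBBA.
Qed.

HB.instance Definition _ := GRing.isZmodMorphism.Build _ _ delta0 delta0_additive.
HB.instance Definition _ := GRing.isZmodMorphism.Build _ _ delta1 delta1_additive.
HB.instance Definition _ := GRing.isZmodMorphism.Build _ _ delta2 delta2_additive.

Definition cocycle1 := cocycle delta1.
Definition cocycle2 := cocycle delta2.
Definition H1 := cohomology delta0 delta1.
Definition H2 := cohomology delta1 delta2.

HB.instance Definition _ := GRing.Zmodule.on cocycle1.
HB.instance Definition _ := GRing.Zmodule.on cocycle2.
HB.instance Definition _ := GRing.Zmodule.on H1.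
HB.instance Definition _ := GRing.Zmodule.on H2.

Definition H1_class : cocycle1 -> H1 := @coh_class _ _ _ delta0 delta1.
Definition H2_class : cocycle2 -> H2 := @coh_class _ _ _ delta1 delta2.

End GroupCohomology.

Section Functoriality.

Variables (G G' : finZmodType) (A A' : zmodType).
Variables (h : {additive G' -> G}) (q : {additive A -> A'}).

Definition cochain2_map (f : {ffun G * G -> A}) : {ffun G' * G' -> A'} :=
  [ffun x : G' * G' => q (f (h x.1, h x.2))].

Lemma cochain2_mapP (f : cocycle2 G A) :
  cochain2_map (cochain f) \in cocycle_pred (@delta2 G' A').
Proof.
case: f => f /= /eqP df; apply/eqP/ffunP => -[[g1 g2] g3].
have /ffunP/(_ (h g1, h g2, h g3)) := df; rewrite !ffunE /= => df'.
by rewrite !(raddfD h) -(raddfB q) -(raddfD q) -(raddfB q) df' raddf0.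
Qed.

Definition cocycle2_map (f : cocycle2 G A) : cocycle2 G' A' :=
  Cocycle (cochain2_mapP f).

(* The map H^2(G, A) -> H^2(G', A') induced by h : G' -> G and q : A -> A'; the
   class of the image does not depend on the representative. *)
Definition H2_map (c : H2 G A) : H2 G' A' := H2_class (cocycle2_map (repr c)).

End Functoriality.

(* The cyclic group Z/r, r > 0, is written 'I_r.-1.+1 ('Z_1 is not trivial).
   This is the inclusion of (1/r)Z/Z in (1/d)Z/Z, for r dividing d, where k in Z/r
   stands for k/r. *)
Definition cyc_incl (r d : nat) of (r %| d)%N : 'I_r.-1.+1 -> 'I_d.-1.+1 :=
  fun k => inZp (k * (d %/ r)).

Lemma cyc_incl_additive (r d : nat) (rd : (r %| d)%N) :
  zmod_morphism (cyc_incl rd).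
Proof.
case: d rd => [|d] rd; first by move=> x y; rewrite [LHS]ord1 [RHS]ord1.
case: r rd => [|r] rd; first by exfalso; move: rd; rewrite dvd0n.
suff fD (x y : 'I_r.+1) : cyc_incl rd (x + y) =
    cyc_incl rd x + cyc_incl rd y.
  by move=> x y; apply: (addIr (cyc_incl rd y)); rewrite -fD !subrK.
by apply: val_inj; rewrite /= muln_modl (mulnC r.+1) divnK // mulnDl modn_mod modnDm.
Qed.

HB.instance Definition _ (r d : nat) (rd : (r %| d)%N) :=
  GRing.isZmodMorphism.Build _ _ (cyc_incl rd) (cyc_incl_additive rd).

(* The class in H^2(G, A) of a central extension 0 -> A -i-> E -f-> G -> 0 (with
   E abelian): the class of (g, h) |-> s(g) + s(h) - s(g + h) for a set-theoretic
   section s of f.  It is unique if the sequence is exact, and the definition is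
   only meaningful in that case. *)
Definition is_ext_class (G : finZmodType) (A E : zmodType) (i : A -> E)
    (f : E -> G) (c : H2 G A) : Prop :=
  exists (s : G -> E) (z : cocycle2 G A), [/\ forall g, f (s g) = g,
    forall g h, i (cochain z (g, h)) = s g + s h - s (g + h) & c = H2_class z].

Definition ext_class (G : finZmodType) (A E : zmodType) (i : A -> E)
    (f : E -> G) : H2 G A := xget 0 [set c | is_ext_class i f c].

(* Subgroups of the group of units of a ring. *)
Section UnitSubgroups.

Variable R : unitRingType.

Definition is_subgroup (X : set R) : Prop :=
  [/\ X `<=` [set x | x \is a GRing.unit], X 1
    & forall x y, X x -> X y -> X (x / y)].

Definition gen_subgroup (X : set R) : set R := smallest is_subgroup X.

Definition cosets (X Y : set R) : set (set R) :=
  [set [set x * y | y in Y] | x in X].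

Definition prod_set (X Y : set R) : set R :=
  [set z | exists x y, [/\ X x, Y y & z = x * y]].

Definition unit_group (S : set R) : set R :=
  [set x | [/\ x \is a GRing.unit, S x & S x^-1]].

Record abelian_subgroup := AbelianSubgroup {
  absub_set :> set R;
  absubP : is_subgroup absub_set;
  absubC : forall x y, absub_set x -> absub_set y -> x * y = y * x }.

(* The elements of an abelian group of units X, as a zmodType: the group
   operation of X is written additively. *)
Record absub_elt (X : abelian_subgroup) :=
  AbsubElt { elt_val :> R; elt_valP : `[< absub_set X elt_val >] }.

Section EltZmodule.

Variable X : abelian_subgroup.

HB.instance Definition _ := [isSub for @elt_val X].
HB.instance Definition _ := [Choice of absub_elt X by <:].

Lemma absub1 : absub_set X 1. Proof. by case: (absubP X). Qed.

Lemma absub_unit x : absub_set X x -> x \is a GRing.unit.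
Proof. by case: (absubP X) => + _ _; apply. Qed.

Lemma absub_div x y :
  absub_set X x -> absub_set X y -> absub_set X (x / y).
Proof. by case: (absubP X) => _ _; apply. Qed.

Lemma absubV x : absub_set X x -> absub_set X x^-1.
Proof. by move=> Xx; rewrite -[x^-1]mul1r; apply: absub_div => //; exact: absub1. Qed.

Lemma absubM x y :
  absub_set X x -> absub_set X y -> absub_set X (x * y).
Proof. by move=> Xx Xy; rewrite -[y]invrK; apply/absub_div/absubV. Qed.

Lemma eltP (x : absub_elt X) : absub_set X (elt_val x).
Proof. exact/asboolP/elt_valP. Qed.

Definition elt0 : absub_elt X := AbsubElt (asboolT absub1).
Definition elt_add (x y : absub_elt X) : absub_elt X :=
  AbsubElt (asboolT (absubM (eltP x) (eltP y))).
Definition elt_opp (x : absub_elt X) : absub_elt X :=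
  AbsubElt (asboolT (absubV (eltP x))).

Lemma elt_addA : associative elt_add.
Proof. by move=> x y z; apply: val_inj; rewrite /= mulrA. Qed.

Lemma elt_addC : commutative elt_add.
Proof.
by move=> x y; apply: val_inj; rewrite /= (absubC (eltP x) (eltP y)).
Qed.

Lemma elt_add0 : left_id elt0 elt_add.
Proof. by move=> x; apply: val_inj; rewrite /= mul1r. Qed.

Lemma elt_addN : left_inverse elt0 elt_opp elt_add.
Proof. by move=> x; apply: val_inj; rewrite /= mulVr // absub_unit //; exact: eltP. Qed.

HB.instance Definition _ :=
  GRing.isZmodule.Build (absub_elt X) elt_addA elt_addC elt_add0 elt_addN.

End EltZmodule.

(* The quotient group X / (X \cap Y), i.e. X / Y if Y is contained in X. *)
Section Quotient.

Variables X Y : abelian_subgroup.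

Definition sub_pred : {pred absub_elt X} := fun x => `[< absub_set Y (elt_val x) >].

Lemma sub_pred_zmod : zmod_closed sub_pred.
Proof.
split=> [|x y /asboolP Yx /asboolP Yy]; apply/asboolP; first exact: absub1.
exact: absub_div.
Qed.

HB.instance Definition _ :=
  GRing.isZmodClosed.Build (absub_elt X) sub_pred sub_pred_zmod.

Definition absub_quot := Quotient.quot sub_pred.
HB.instance Definition _ := GRing.Zmodule.on absub_quot.

Definition quot_class : absub_elt X -> absub_quot := \pi_(Quotient.quot sub_pred).

Lemma quot_class_additive : zmod_morphism quot_class.
Proof. by move=> x y; exact: raddfB. Qed.

HB.instance Definition _ :=
  GRing.isZmodMorphism.Build _ _ quot_class quot_class_additive.

End Quotient.

Lemma powers_subgroup (a : R) : a \is a GRing.unit ->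
  is_subgroup [set a ^ k | k in [set: int]].
Proof.
move=> ua; split=> [_ [k _ <-]||_ _ [k _ <-] [l _ <-]] /=.
- exact: unitrXz.
- by exists 0.
- by exists (k - l) => //; rewrite exprzDr // invr_expz.
Qed.

Lemma powers_comm (a : R) x y : [set a ^ k | k in [set: int]] x ->
  [set a ^ k | k in [set: int]] y -> x * y = y * x.
Proof. by move=> [k _ <-] [l _ <-]; exact/commrXz/commr_sym/commrXz. Qed.

Definition powers (a : R) (ua : a \is a GRing.unit) : abelian_subgroup :=
  AbelianSubgroup (powers_subgroup ua) (@powers_comm a).

End UnitSubgroups.

Section DivisionAlgebra.

Variables (p : nat) (p_pr : prime p) (D : falgType (padic p_pr)).
Implicit Types (x y : D) (v : D -> rat).

Definition Zp_scal (a : padic_int p_pr) : D := (Zp_to_Qp a)%:A.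

(* The valuation D^* -> (1/n)Z with v(p) = 1. The fields valuation_p and
   valuation_Zp say that it extends the p-adic valuation of Q_p (they imply
   v(a) = 0 for a in Z_p^* ). The value of v at 0 is irrelevant. *)
Record is_valuation (n : nat) v : Prop := {
  valuationM : forall x y, x != 0 -> y != 0 -> v (x * y) = v x + v y;
  valuationD : forall x y, x != 0 -> y != 0 -> x + y != 0 ->
    Num.min (v x) (v y) <= v (x + y);
  valuation_p : v p%:R = 1;
  valuation_Zp : forall a, a != 0 -> 0 <= v (Zp_scal a);
  valuation_range : forall x, x != 0 -> n%:R * v x \is a Num.int }.

(* The Hasse invariant of a central division algebra of dimension n^2 over Q_p is
   q mod Z: there are an unramified extension L of Q_p of degree n in D and an
   element g normalizing L, inducing the Frobenius automorphism of L by
   conjugation, with v(g) = q mod Z. *)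
Definition has_hasse_invariant (n : nat) v (q : rat) : Prop :=
  exists (L : {aspace D}) (g : D),
  [/\ [/\ 1 \in L, \dim L = n, forall x y, x \in L -> y \in L -> x * y = y * x
        & forall x, x \in L -> x != 0 -> v x \is a Num.int],
      g != 0 /\ (forall x, x \in L -> g * x * g^-1 \in L),
      forall x, x \in L -> x != 0 -> 0 <= v x ->
        g * x * g^-1 = x ^+ p \/ 0 < v (g * x * g^-1 - x ^+ p)
    & v g - q \is a Num.int].

(* D is the central division algebra D_n of Hasse invariant 1/n, and v its
   valuation. *)
Record is_Dn (n : nat) v : Prop := {
  Dn_division : forall x, x != 0 -> x \is a GRing.unit;
  Dn_central : forall x, (forall y, x * y = y * x) -> exists a, x = a%:A;
  Dn_dim : \dim {:D} = (n ^ 2)%N;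
  Dn_valuation : is_valuation n v;
  Dn_hasse : has_hasse_invariant n v n%:R^-1 }.

Definition is_subalgebra (K : set (padic p_pr)) (S : set D) : Prop :=
  [/\ S 1, forall x y, S x -> S y -> S (x - y),
      forall x y, S x -> S y -> S (x * y)
    & forall a x, K a -> S x -> S (a *: x)].

Definition Zp_set : set (padic p_pr) := range (@Zp_to_Qp p p_pr).

(* A Z_p-order of D: a Z_p-subalgebra, finitely generated as a Z_p-module, that
   spans D over Q_p. *)
Definition is_order (O : set D) : Prop :=
  [/\ is_subalgebra Zp_set O,
      exists s : seq D, O =
        [set x | exists a : nat -> padic_int p_pr,
           x = \sum_(i < size s) Zp_to_Qp (a i) *: s`_i]
    & forall x, exists2 a : padic_int p_pr, a != 0 & O (Zp_to_Qp a *: x)].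

Definition is_maximal_order (O : set D) : Prop :=
  is_order O /\ forall O', is_order O' -> O `<=` O' -> O' = O.

(* The algebra generated by F over K: Q_p(F) for K = Q_p, Z_p(F) for K = Z_p. *)
Definition gen_algebra (K : set (padic p_pr)) (F : set D) : set D :=
  smallest (is_subalgebra K) F.

Lemma gen_algebra_subalgebra K F : is_subalgebra K (gen_algebra K F).
Proof.
split=> [S [[]]//|x y Sx Sy S HS|x y Sx Sy S HS|a x Ka Sx S HS].
- by have [[_ SB _ _] _] := HS; apply: SB; [exact: Sx|exact: Sy].
- by have [[_ _ SM _] _] := HS; apply: SM; [exact: Sx|exact: Sy].
- by have [[_ _ _ SZ] _] := HS; apply: SZ => //; exact: Sx.
Qed.

Lemma centralizer_subalgebra K (F : set D) :
  is_subalgebra K [set x | forall y, F y -> x * y = y * x].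
Proof.
split=> [y _|x y cx cy z Fz|x y cx cy z Fz|a x _ cx z Fz] /=.
- by rewrite mul1r mulr1.
- by rewrite mulrBl mulrBr cx ?cy.
- by rewrite -mulrA cy // mulrA cx // mulrA.
- by rewrite -scalerAl -scalerAr cx.
Qed.

Lemma gen_algebra_comm K (F : abelian_subgroup D) x y :
  gen_algebra K F x -> gen_algebra K F y -> x * y = y * x.
Proof.
move=> Fx Fy; move: x Fx y Fy.
have sub1 x : gen_algebra K F x -> forall y, absub_set F y -> x * y = y * x.
  apply: (smallest_sub (centralizer_subalgebra K F)) => z Fz y Fy.
  exact: absubC Fz Fy.
move=> x Fx y Fy; apply/esym; move: y Fy x Fx.
apply: (smallest_sub (centralizer_subalgebra K (gen_algebra K F))).
by move=> z Fz y Fy; rewrite (sub1 y).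
Qed.

Lemma units_subgroup K (F : set D) : is_subgroup (unit_group (gen_algebra K F)).
Proof.
have [S1 _ SM _] := gen_algebra_subalgebra K F.
split=> [x [] //||x y [ux Sx Sx'] [uy Sy Sy']].
  by split; rewrite ?invr1 ?unitr1.
have uy' : y^-1 \is a GRing.unit by rewrite unitrV.
by split; [rewrite unitrMr|exact: SM|rewrite invrM ?invrK//; exact: SM].
Qed.

(* The unit groups Q_p(F0)^* and Z_p(F0)^*. *)
Definition gen_units (K : set (padic p_pr)) (F : abelian_subgroup D) :
    abelian_subgroup D :=
  AbelianSubgroup (units_subgroup K F)
    (fun x y '(And3 _ Fx _) '(And3 _ Fy _) => gen_algebra_comm Fx Fy).

Definition Qp_units := gen_units setT.
Definition Zp_units := gen_units Zp_set.

Lemma gen_algebra_sub K K' (F : set D) :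
  K `<=` K' -> gen_algebra K F `<=` gen_algebra K' F.
Proof.
move=> KK'; apply: smallest_sub; last exact: sub_gen_smallest.
have [S1 SB SM SZ] := gen_algebra_subalgebra K' F.
by split=> // a x /KK'; exact: SZ.
Qed.

Lemma Zp_units_sub (F : abelian_subgroup D) : Zp_units F `<=` Qp_units F.
Proof.
by move=> x [ux Fx Fx']; split=> //;
  [exact: gen_algebra_sub Fx|exact: gen_algebra_sub Fx'].
Qed.

Section Pu.

Variables (u : padic_int p_pr) (u_unit : u \is a GRing.unit).

Definition pu : D := Zp_scal (p%:R * u).

Lemma Zp_to_Qp_pu_neq0 : Zp_to_Qp (p%:R * u) != 0.
Proof.
rewrite /Zp_to_Qp tofrac_eq0 mulf_neq0 ?padic_p_neq0 //.
by apply: contraTneq u_unit => ->; rewrite unitr0.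
Qed.

Lemma pu_unit : pu \is a GRing.unit.
Proof. by rewrite /pu /Zp_scal scaler_unit ?unitr1 // unitfE Zp_to_Qp_pu_neq0. Qed.

(* The infinite cyclic group <pu>. *)
Definition pu_group : abelian_subgroup D := powers pu_unit.

Lemma pu_group_sub (F : abelian_subgroup D) : pu_group `<=` Qp_units F.
Proof.
have [S1 _ SM SZ] := gen_algebra_subalgebra setT F.
have pu_in : absub_set (Qp_units F) pu.
  split; [exact: pu_unit|exact: SZ|].
  rewrite /pu /Zp_scal invrZ ?unitr1 ?unitfE ?Zp_to_Qp_pu_neq0 // invr1.
  exact: SZ.
have Xn m : absub_set (Qp_units F) (pu ^+ m).
  elim: m => [|m IH]; first by rewrite expr0; exact: absub1.
  by rewrite exprS; exact: absubM.
by move=> _ [[m|m] _ <-]; [exact: Xn|exact/absubV/Xn].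
Qed.

End Pu.

Section Extension.

Variables (v : D -> rat) (F0 : abelian_subgroup D).
Variables (u : padic_int p_pr) (u_unit : u \is a GRing.unit).

Local Notation P := (pu_group u_unit).

(* F0 x <pu> inside D^* *)
Definition F0_tilde : set D := prod_set F0 P.

(* The index of v(Q_p^* ) in v(Q_p(F0)^* ). *)
Definition ramification_index : nat :=
  #|` fset_set [set [set q + v a%:A | a in [set a : padic p_pr | a != 0]]
                | q in [set v x | x in (Qp_units F0 : set D)]]|.

Local Notation e := ramification_index.

(* Z_p(F0)^* x <pu> -> Q_p(F0)^* *)
Lemma ext_incl_subproof (zw : absub_elt (Zp_units F0) * absub_elt P) :
  `[< absub_set (Qp_units F0) (elt_val zw.1 * elt_val zw.2) >].
Proof.
apply/asboolP/absubM; first exact/Zp_units_sub/eltP.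
exact/(@pu_group_sub _ u_unit)/eltP.
Qed.

Definition ext_incl (zw : absub_elt (Zp_units F0) * absub_elt P) :
  absub_elt (Qp_units F0) := AbsubElt (ext_incl_subproof zw).

(* x |-> v(x) mod Z, with k in Z/e standing for k/e in (1/e)Z/Z; note that e v(x)
   is an integer. *)
Definition ext_proj (x : absub_elt (Qp_units F0)) : 'I_e.-1.+1 :=
  inZp 1 *~ Num.floor (e%:R * v (elt_val x)).

Definition e_u : H2 'I_e.-1.+1 (absub_elt (Zp_units F0) * absub_elt P)%type :=
  ext_class ext_incl ext_proj.

(* The projection of Z_p(F0)^* x <pu> onto its quotient by F0 x <pu>, identified
   with Z_p(F0)^* / F0. *)
Definition coef_proj (zw : absub_elt (Zp_units F0) * absub_elt P) :
  absub_quot (Zp_units F0) F0 := quot_class F0 zw.1.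

Lemma coef_proj_additive : zmod_morphism coef_proj.
Proof. by move=> x y; rewrite /coef_proj raddfB. Qed.

HB.instance Definition _ :=
  GRing.isZmodMorphism.Build _ _ coef_proj coef_proj_additive.

Definition e_u_res (r : nat) (re : (r %| e)%N) :
    H2 'I_r.-1.+1 (absub_elt (Zp_units F0) * absub_elt P)%type :=
  H2_map (cyc_incl re) idfun e_u.

(* The image of e_u(F0, r) in H^2(Z/r, Z_p(F0)^* / F0). *)
Definition e_u_image (r : nat) (re : (r %| e)%N) :
    H2 'I_r.-1.+1 (absub_quot (Zp_units F0) F0) :=
  H2_map idfun coef_proj (e_u_res re).

(* The map X/Y -> (1/n)Z/Z induced by v is defined and injective. *)
Definition induces_injection (n : nat) (X Y : set D) : Prop :=
  [/\ forall x, X x -> n%:R * v x \is a Num.int,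
      forall y, Y y -> v y \is a Num.int
    & forall x y, X x -> X y -> v x - v y \is a Num.int -> Y (x / y)].

Definition F_tilde (n r : nat) : set (set D) :=
  [set F1 | [/\ is_subgroup F1, F1 `<=` Qp_units F0, F0_tilde `<=` F1,
     induces_injection n F1 F0_tilde & (cosets F1 F0_tilde #= `I_r)%card]].

End Extension.

End DivisionAlgebra.

Arguments F0_tilde {p p_pr D} F0 {u} u_unit.
Arguments e_u {p p_pr D} v F0 {u} u_unit.
Arguments e_u_res {p p_pr D} v F0 {u} u_unit {r} re.
Arguments e_u_image {p p_pr D} v F0 {u} u_unit {r} re.
Arguments F_tilde {p p_pr D} v F0 {u} u_unit n r.

(* Main.v *)
(* Put K = Q_p(F0) and R = Z_p(F0). Exactness of the extension means that an
   element of K of valuation 0 lies in R^*, i.e. that R is the valuation ring of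
   K. For q a suitable power of p, y = x^q satisfies y^q = y mod p for every x
   in R. If v(y) > 0, the sequence y^(q^k) tends to 0 while consecutive terms
   differ by multiples of p^(k+1), so y is p times a convergent series in the
   p-adically complete ring R. Modulo pi = 1 - zeta, zeta a generator of the
   p-primary part of F0 (pi = p if this part is trivial), x^q = x and p = 0.
   Hence every element of R of positive valuation is divisible by pi, and as
   some power of pi is divisible by p, every element of K of nonnegative
   valuation is in R.

   The members of the set F_tilde of level r are then the groups <F0~, x> with
   v(x) = 1/r and x^r in F0~. A cochain trivializing the class e_u(F0, r) in
   Z_p(F0)^*/F0 corrects a section of v to a homomorphism modulo F0~, whose
   value at 1/r is such an x, and conversely. Two choices of x differ by an
   element y of Z_p(F0)^* with y^r in F0, i.e. by a homomorphism
   Z/r -> Z_p(F0)^*/F0. *)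
Require Import Defs.
From HB Require Import structures.
From mathcomp Require Import all_boot all_order all_algebra all_field.
From mathcomp Require Import ring.
From mathcomp Require Import boolp classical_sets functions cardinality.

Import Order.TTheory GRing.Theory Num.Theory.

Set Implicit Arguments.
Unset Strict Implicit.
Unset Printing Implicit Defensive.

Local Open Scope classical_set_scope.
Local Open Scope ring_scope.

(** * p-adic integers *)

Section PadicArithmetic.

Variables (p : nat) (p_pr : prime p).
Implicit Types a b : padic_int p_pr.

Lemma residueM a b i : (a * b) i = ((a i * b i) %% (p ^ i)%N)%Z.
Proof. by []. Qed.

Lemma residueB a b i : (a - b) i = ((a i - b i) %% (p ^ i)%N)%Z.
Proof. by rewrite /= /of_coherent modzDmr. Qed.

(** Division by p loses one level of precision: at level i the quotient has the residue [a i.+1]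
    divided by p. *)
Lemma residue1_eq0 a : a 1%N = 0 -> exists b, a = p%:R * b.
Proof.
move=> a1.
have p_gt0 := prime_gt0 p_pr.
have p_neq0 : p%:Z != 0 by rewrite eqz_nat -lt0n.
have dvd_a i : (p %| a i.+1)%Z.
  by apply/dvdz_mod0P; move: a1; rewrite (residueD a 1 i) add1n expn1.
pose f i := (a i.+1 %/ p)%Z.
have fE i : a i.+1 = f i * p by rewrite divzK.
have fP i : f i = (f i.+1 %% (p ^ i)%N)%Z.
  apply: (mulIf p_neq0).
  by rewrite mulz_modl ?ltz_nat // -!fE -PoszM -expnSr -residueP.
exists (PadicInt fP : padic_int p_pr); apply/padic_int_inj/funext => i.
by rewrite residueM residue_nat /= modzMml mulrC -fE -residueP.
Qed.

Lemma residue_eq0 a N : a N = 0 -> exists b, a = p%:R ^+ N * b.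
Proof.
elim: N a => [|N IH] a aN; first by exists a; rewrite mul1r.
have [b ab] : exists b, a = p%:R * b.
  apply: residue1_eq0; have := residueD a 1 N.
  by rewrite add1n aN mod0z.
have [c bc] : exists c, b = p%:R ^+ N * c.
  apply: IH; rewrite (residueP b N); apply/dvdz_mod0P.
  have : ((p%:R * b : padic_int p_pr) N.+1) = 0 by rewrite -ab.
  rewrite residueM residue_nat modzMml => /dvdz_mod0P.
  by rewrite expnS PoszM dvdz_mul2l // eqz_nat -lt0n prime_gt0.
by exists c; rewrite ab bc exprS mulrA.
Qed.

Lemma residue_add a b i : (a + b) i = ((a i + b i) %% (p ^ i)%N)%Z.
Proof. by []. Qed.

Lemma residue1X a k : (a ^+ k) 1%N = (a 1%N ^+ k %% p)%Z.
Proof.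
elim: k => [|k IH]; first by rewrite /= /of_coherent expn1.
by rewrite !exprS residueM IH expn1 modzMmr.
Qed.

Lemma residue1_nat a : exists m : nat, a 1%N = m.
Proof.
have : 0 <= a 1%N.
  by rewrite -residue_mod modz_ge0 // eqz_nat expn1 -lt0n prime_gt0.
by case: (a 1%N) => // m _; exists m.
Qed.

Lemma padic_fermat a : exists b, a ^+ p - a = p%:R * b.
Proof.
apply: residue1_eq0; rewrite residueB residue1X expn1 modzDml.
have [m ->] := residue1_nat a.
apply/dvdz_mod0P; rewrite -eqz_mod_dvd -rmorphXn !modz_nat.
by apply/eqP; rewrite fermat_little.
Qed.

(** At level i the limit has the residue of the i-th partial sum, all later terms being divisible by
    p^i. *)
Lemma padic_complete (c : nat -> padic_int p_pr) :
  exists a, forall N, exists b,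
    a - \sum_(k < N) p%:R ^+ k * c k = p%:R ^+ N * b.
Proof.
pose S N := \sum_(k < N) p%:R ^+ k * c k.
have pX0 N (b : padic_int p_pr) : (p%:R ^+ N * b) N = 0.
  rewrite -natrX residueM residue_nat modzMml; apply/dvdz_mod0P.
  exact/dvdz_mulr.
have SP i : S i i = (S i.+1 i.+1 %% (p ^ i)%N)%Z.
  by rewrite -residueP [S i.+1]big_ord_recr residue_add (pX0 i) addr0 residue_mod.
exists (PadicInt SP : padic_int p_pr) => N; apply: residue_eq0.
by rewrite residueB subrr mod0z.
Qed.

Lemma padic_pX_dvd_eq0 a : (forall N, exists b, a = p%:R ^+ N * b) -> a = 0.
Proof.
move=> dvd_a; apply/padic_int_inj/funext => i; have [b ->] := dvd_a i.
rewrite -natrX residueM residue_nat modzMml (residue_nat p_pr 0) mod0z.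
exact/dvdz_mod0P/dvdz_mulr.
Qed.

(** The geometric series in -p d converges to the inverse: multiplied by 1 + p d, its partial sums
    telescope to 1 up to a multiple of p^N. *)
Lemma padic_unit_1Dp (d : padic_int p_pr) : 1 + p%:R * d \is a GRing.unit.
Proof.
have [t tP] := padic_complete (fun k => (- d) ^+ k).
apply/unitrPr; exists t; apply/eqP; rewrite -subr_eq0; apply/eqP.
apply: padic_pX_dvd_eq0 => N; have [b tN] := tP N.
exists ((1 + p%:R * d) * b - (- d) ^+ N).
rewrite mulrBr mulrCA -tN mulrBr mulr_sumr.
have -> : \sum_(k < N) (1 + p%:R * d) * (p%:R ^+ k * (- d) ^+ k) =
    1 - p%:R ^+ N * (- d) ^+ N.
  elim: N {b tN} => [|N IH]; first by rewrite big_ord0 mulr1 subrr.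
  rewrite big_ord_recr /= IH !exprS; ring.
by ring.
Qed.

(** Induction on a level where the residue is nonzero: removing a factor p lowers this level by one,
    until a is nonzero modulo p. *)
Lemma padic_factor a : a != 0 ->
  exists k b, a = p%:R ^+ k * b /\ b \is a GRing.unit.
Proof.
move=> /residue_neq0[i]; elim: i a => [|i IH] a ai.
  by case/negP: ai; rewrite -residue_mod expn0 modz1.
have [a1|a1] := eqVneq (a 1%N) 0.
  have [b ab] := residue1_eq0 a1.
  have [|k [c [bc H]]] := IH b.
    apply: contraNneq ai => bi; have [d bd] := residue_eq0 bi.
    rewrite ab bd mulrA -exprS -natrX residueM residue_nat modzMml.
    exact/eqP/dvdz_mod0P/dvdz_mulr.
  by exists k.+1, c; split=> //; rewrite ab bc mulrA -exprS.
exists 0, a; split; first by rewrite expr0 mul1r.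
have p_gt0 := prime_gt0 p_pr.
have [m am] := residue1_nat a.
have cop : coprime m p.
  rewrite coprime_sym prime_coprime //; apply: contraNN a1 => pm.
  by rewrite -residue_mod am expn1; exact/eqP/dvdz_mod0P.
have one1 : (1 : padic_int p_pr) 1%N = 1.
  by rewrite (residue_nat p_pr 1) expn1 modz_small // ltz_nat prime_gt1.
(* By Euler's theorem a power of a has the form 1 + p d, which is a unit; hence a is one. *)
have [d ad] : exists d, a ^+ totient p - 1 = p%:R * d.
  apply: residue1_eq0; rewrite residueB residue1X expn1 modzDml am one1.
  apply/dvdz_mod0P; rewrite -eqz_mod_dvd -rmorphXn !modz_nat.
  by apply/eqP; rewrite cyclic.Euler_exp_totient.
rewrite -(unitrX_pos a (_ : 0 < totient p)%N) ?totient_gt0 //.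
by rewrite -(subrK 1 (a ^+ _)) ad addrC padic_unit_1Dp.
Qed.

End PadicArithmetic.

Lemma fraction_tofrac (R : idomainType) (x : {fraction R}) :
  exists a b, b != 0 /\ tofrac b * x = tofrac a.
Proof.
elim/quotW: x => x; exists (frac x).1, (frac x).2; split; first exact: denom_ratioP.
rewrite -[LHS]/(FracField.mul _ _); apply/eqP; rewrite !piE.
rewrite FracField.equivfE /FracField.mulf.
by rewrite !numden_Ratio ?mul1r ?mulr1 ?oner_eq0 ?denom_ratioP //= mulrC.
Qed.

(** * Congruences and p-th powers in commutative rings *)

Section Divisibility.

Variable A : comNzRingType.
Implicit Types d x y z : A.

(** A congruence between x and y modulo d is written [dvdr d (x - y)] throughout. *)
Definition dvdr d x := exists r, x = d * r.

Lemma dvdr0 d : dvdr d 0. Proof. by exists 0; rewrite mulr0. Qed.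

Lemma dvdrr d : dvdr d d. Proof. by exists 1; rewrite mulr1. Qed.

Lemma dvdrD d x y : dvdr d x -> dvdr d y -> dvdr d (x + y).
Proof. by move=> [r ->] [s ->]; exists (r + s); rewrite mulrDr. Qed.

Lemma dvdrN d x : dvdr d x -> dvdr d (- x).
Proof. by move=> [r ->]; exists (- r); rewrite mulrN. Qed.

Lemma dvdrB d x y : dvdr d x -> dvdr d y -> dvdr d (x - y).
Proof. by move=> dx dy; apply/dvdrD/dvdrN. Qed.

Lemma dvdr_mull d x y : dvdr d y -> dvdr d (x * y).
Proof. by move=> [r ->]; exists (x * r); rewrite mulrCA. Qed.

Lemma dvdr_mulr d x y : dvdr d x -> dvdr d (x * y).
Proof. by rewrite mulrC; exact: dvdr_mull. Qed.

Lemma dvdr_mul c d x y : dvdr c x -> dvdr d y -> dvdr (c * d) (x * y).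
Proof. by move=> [r ->] [s ->]; exists (r * s); rewrite mulrACA. Qed.

Lemma dvdr_trans x d y : dvdr d x -> dvdr x y -> dvdr d y.
Proof. by move=> dx [r ->]; exact: dvdr_mulr. Qed.

Lemma dvdr_sum d (I : Type) (s : seq I) (P : pred I) (F : I -> A) :
  (forall i, P i -> dvdr d (F i)) -> dvdr d (\sum_(i <- s | P i) F i).
Proof. by move=> dF; elim/big_ind: _ => //; [exact: dvdr0|exact: dvdrD]. Qed.

Lemma dvdr_sub_trans d y x z : dvdr d (x - y) -> dvdr d (y - z) -> dvdr d (x - z).
Proof. by move=> /dvdrD/[apply]; rewrite addrA subrK. Qed.

Lemma dvdr_subC d x y : dvdr d (x - y) -> dvdr d (y - x).
Proof. by move=> /dvdrN; rewrite opprB. Qed.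

Lemma dvdr_subM d x y x' y' :
  dvdr d (x - y) -> dvdr d (x' - y') -> dvdr d (x * x' - y * y').
Proof.
move=> xy xy'; apply: (@dvdr_sub_trans _ (y * x')).
  by rewrite -mulrBl; exact: dvdr_mulr.
by rewrite -mulrBr; exact: dvdr_mull.
Qed.

Lemma dvdr_subX d x y k : dvdr d (x - y) -> dvdr d (x ^+ k - y ^+ k).
Proof. by move=> xy; rewrite subrXX; exact: dvdr_mulr. Qed.

Lemma dvdr_expl d x k l : (k <= l)%N -> dvdr (d ^+ l) x -> dvdr (d ^+ k) x.
Proof.
move=> kl; apply: dvdr_trans; exists (d ^+ (l - k)).
by rewrite -exprD subnKC.
Qed.

Variables (p : nat) (p_pr : prime p).

(** The inner binomial coefficients are divisible by p. Writing p as [m.+2] lets the two extreme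
    terms be split off. *)
Lemma dvdr_frobeniusD x y : dvdr p%:R ((x + y) ^+ p - (x ^+ p + y ^+ p)).
Proof.
case: p p_pr => [|[|m]] // m_pr.
rewrite exprDn big_ord_recl big_ord_recr /= /bump /= add1n subn0 subnn.
rewrite expr0 mulr1 mul1r bin0 binn !mulr1n addrA addrAC -addrA opprD.
rewrite [X in dvdr _ X](_ : _ = \sum_(i < m.+1)
    x ^+ (m.+2 - i.+1) * y ^+ i.+1 *+ 'C(m.+2, i.+1)); last by ring.
apply: dvdr_sum => i _.
have /dvdnP[c ->] : (m.+2 %| 'C(m.+2, i.+1))%N.
  by apply: prime_dvd_bin; rewrite //= ltnS.
by rewrite -[X in dvdr _ X]mulr_natr natrM; exact/dvdr_mull/dvdr_mull/dvdrr.
Qed.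

(** Additivity of the p^k-th power modulo p is applied to (x - y) + y, which avoids the sign of
    (-1)^(p^k). *)
Lemma dvdr_frobeniusB k x y :
  dvdr p%:R ((x - y) ^+ (p ^ k) - (x ^+ (p ^ k) - y ^+ (p ^ k))).
Proof.
have frobD z t : dvdr p%:R ((z + t) ^+ (p ^ k) - (z ^+ (p ^ k) + t ^+ (p ^ k))).
  elim: k => [|k IH]; first by rewrite !expr1 subrr; exact: dvdr0.
  rewrite expnSr !exprM; apply: dvdr_sub_trans (dvdr_subX p IH) _.
  exact: dvdr_frobeniusD.
have := dvdr_subC (frobD (x - y) y); rewrite subrK.
rewrite [X in dvdr _ X -> _](_ : _ =
    (x - y) ^+ (p ^ k) - (x ^+ (p ^ k) - y ^+ (p ^ k))) //; ring.
Qed.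

(** Each further p-th power gains a factor p: if a = b modulo p, the cofactor of a - b in a^p - b^p
    is a sum of p terms, all congruent to b^(p-1) modulo p. *)
Lemma dvdr_expp k x y : dvdr p%:R (x - y) ->
  dvdr (p%:R ^+ k.+1) (x ^+ (p ^ k) - y ^+ (p ^ k)).
Proof.
move=> xy; elim: k => [|k IH]; first by rewrite !expr1.
rewrite expnSr !exprM subrXX exprSr; apply: dvdr_mul => //.
set a := x ^+ _ in IH *; set b := y ^+ _ in IH *.
have ab : dvdr p%:R (a - b) by have := dvdr_expl (ltn0Sn k) IH; rewrite expr1.
rewrite -[\sum_(i < p) _](subrK (\sum_(i < p) b ^+ p.-1)).
apply: dvdrD; last first.
  by rewrite sumr_const card_ord -[X in dvdr _ X]mulr_natl; exact/dvdr_mulr/dvdrr.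
rewrite -sumrB; apply: dvdr_sum => i _.
have -> : b ^+ p.-1 = b ^+ (p.-1 - i) * b ^+ i.
  by rewrite -exprD subnK // -ltnS prednK ?prime_gt0.
by apply: dvdr_subM; [exact: dvdr_subX|rewrite subrr; exact: dvdr0].
Qed.

Lemma dvdr_sub1X x k : dvdr (1 - x) (1 - x ^+ k).
Proof. by rewrite -[X in dvdr _ (X - _)](expr1n A k) subrXX; exact/dvdr_mulr/dvdrr. Qed.

(** If x^p = 1, then 1 + x + ... + x^(p-1) = 0, so p is the sum of the 1 - x^i, each divisible by 1
    - x. Otherwise 1 - x divides 1 - x^p, to which the induction hypothesis applies. *)
Lemma dvdr_root_of_unity_p k x :
  (forall y z : A, y * z = 0 -> y = 0 \/ z = 0) ->
  x ^+ (p ^ k) = 1 -> x <> 1 -> dvdr (1 - x) p%:R.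
Proof.
move=> A_dom; elim: k x => [|k IH] x; first by rewrite expr1 => ->.
have [xp1 _ x1|xp1 xk _] := pselect (x ^+ p = 1); last first.
  apply: dvdr_trans (dvdr_sub1X x p) (IH _ _ xp1).
  by rewrite -exprM -expnS.
have sum0 : \sum_(i < p) x ^+ i = 0.
  have := subrX1 x p; rewrite xp1 subrr => /esym/A_dom[/subr0_eq//|//].
have -> : p%:R = \sum_(i < p) (1 - x ^+ i).
  by rewrite sumrB sum0 subr0 sumr_const card_ord.
by apply: dvdr_sum => i _; exact: dvdr_sub1X.
Qed.

(** Modulo p the power (1 - x)^(p^k) equals 1 - x^(p^k). With the preceding lemma, 1 - x divides p
    and p divides a power of 1 - x. *)
Lemma dvdr_p_sub1X k x : x ^+ (p ^ k) = 1 -> dvdr p%:R ((1 - x) ^+ (p ^ k)).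
Proof.
by move=> xk; have := dvdr_frobeniusB k 1 x; rewrite xk expr1n subrr subr0.
Qed.

End Divisibility.

(** * Valuations *)

Section Valuation.

Variables (p : nat) (p_pr : prime p) (D : falgType (padic p_pr)).
Variables (n : nat) (v : D -> rat).
Hypothesis D_div : forall x : D, x != 0 -> x \is a GRing.unit.
Hypothesis vP : is_valuation n v.
Implicit Types x y : D.

Lemma unit_neq0 x : x \is a GRing.unit -> x != 0.
Proof. by apply: contraTneq => ->; rewrite unitr0. Qed.

Lemma Dmulf_eq0 x y : x * y = 0 -> x = 0 \/ y = 0.
Proof.
have [->|/D_div ux] := eqVneq x 0; first by left.
by move=> /(canRL (mulKr ux)); rewrite mulr0; right.
Qed.

Lemma Dmulf_neq0 x y : x != 0 -> y != 0 -> x * y != 0.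
Proof. by move=> x0 y0; apply/eqP => /Dmulf_eq0[/eqP|/eqP]; apply/negP. Qed.

Lemma Dexpf_neq0 x k : x != 0 -> x ^+ k != 0.
Proof.
by move=> x0; elim: k => [|k IH]; rewrite ?expr0 ?oner_eq0 // exprS Dmulf_neq0.
Qed.

Lemma v1 : v 1 = 0.
Proof.
by apply: (addrI (v 1)); rewrite -(valuationM vP) ?oner_neq0 // mulr1 addr0.
Qed.

Lemma vX x k : x != 0 -> v (x ^+ k) = k%:R * v x.
Proof.
move=> x0; elim: k => [|k IH]; first by rewrite mul0r v1.
by rewrite exprS (valuationM vP) ?Dexpf_neq0 // IH -natr1 addrC mulrDl mul1r.
Qed.

Lemma v_root1 x k : (0 < k)%N -> x ^+ k = 1 -> v x = 0.
Proof.
move=> k0 xk; have x0 : x != 0.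
  by apply: contraTneq (oner_neq0 D) => x0; rewrite -xk x0 expr0n -[k]prednK ?eqxx.
apply/eqP; have := vX k x0; rewrite xk v1 => /esym/eqP.
by rewrite mulf_eq0 pnatr_eq0 -[k]prednK.
Qed.

Lemma vN x : x != 0 -> v (- x) = v x.
Proof.
move=> x0; rewrite -mulN1r (valuationM vP) ?oppr_eq0 ?oner_neq0 //.
by rewrite (v_root1 (k := 2)) ?add0r // sqrrN expr1n.
Qed.

Lemma vV x : x != 0 -> v x^-1 = - v x.
Proof.
move=> x0; have ux := D_div x0; apply: (addrI (v x)).
by rewrite -(valuationM vP) ?unit_neq0 ?unitrV // mulrV // v1 subrr.
Qed.

Lemma vZ x (k : int) : x != 0 -> v (x ^ k) = k%:~R * v x.
Proof.
move=> x0; case: k => k; first exact: vX.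
by rewrite NegzE -exprnN vV ?Dexpf_neq0 // vX // mulrNz mulNr.
Qed.

(** The first alternative encodes v(0) = +infinity, since the value of [v] at 0 is arbitrary. *)
Definition val_ge (c : rat) x := x = 0 \/ c <= v x.

Lemma val_geD c x y : val_ge c x -> val_ge c y -> val_ge c (x + y).
Proof.
have [->|x0] := eqVneq x 0; first by rewrite add0r.
have [->|y0] := eqVneq y 0; first by rewrite addr0.
have [->|xy0] := eqVneq (x + y) 0; first by left.
case=> [/eqP|cx]; first by rewrite (negPf x0).
case=> [/eqP|cy]; first by rewrite (negPf y0).
by right; apply: le_trans (valuationD vP x0 y0 xy0); rewrite le_min cx.
Qed.

Lemma val_geN c x : val_ge c x -> val_ge c (- x).
Proof.
have [->|x0] := eqVneq x 0; first by rewrite oppr0.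
by case=> [/eqP|cx]; [rewrite (negPf x0)|right; rewrite vN].
Qed.

Lemma val_geB c x y : val_ge c x -> val_ge c y -> val_ge c (x - y).
Proof. by move=> cx cy; apply/val_geD/val_geN. Qed.

Lemma val_geM c d x y : val_ge c x -> val_ge d y -> val_ge (c + d) (x * y).
Proof.
have [->|x0] := eqVneq x 0; first by rewrite mul0r; left.
have [->|y0] := eqVneq y 0; first by rewrite mulr0; left.
case=> [/eqP|cx]; first by rewrite (negPf x0).
case=> [/eqP|cy]; first by rewrite (negPf y0).
by right; rewrite (valuationM vP) // lerD.
Qed.

Lemma val_geX c x k : val_ge c x -> val_ge (k%:R * c) (x ^+ k).
Proof.
move=> cx; elim: k => [|k IH]; first by right; rewrite v1 mul0r.
by rewrite exprS -natr1 addrC mulrDl mul1r; exact: val_geM.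
Qed.

Lemma val_ge_le c d x : c <= d -> val_ge d x -> val_ge c x.
Proof. by move=> cd [->|dx]; [left|right; exact: le_trans dx]. Qed.

Lemma val_ge_eq0 x : (forall N : nat, val_ge N%:R x) -> x = 0.
Proof.
move=> xN; have [//|x0] := eqVneq x 0.
case: (xN (Num.truncn (v x)).+1) => [//|]; have := truncnS_gt (v x).
by move=> /lt_le_trans/[apply]; rewrite ltxx.
Qed.

Lemma Zp_scalB : {morph @Zp_scal p p_pr D : a b / a - b}.
Proof. by move=> a b; rewrite /Zp_scal /Zp_to_Qp tofracB scalerBl. Qed.

Lemma Zp_scalM : {morph @Zp_scal p p_pr D : a b / a * b}.
Proof.
by move=> a b; rewrite /Zp_scal /Zp_to_Qp tofracM -scalerAl mul1r scalerA.
Qed.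

Lemma Zp_scal1 : Zp_scal D 1 = 1.
Proof. by rewrite /Zp_scal /Zp_to_Qp tofrac1 scale1r. Qed.

(** Both a and its inverse have nonnegative valuation, and the two valuations add up to v(1) = 0. *)
Lemma v_Zp_unit (a : padic_int p_pr) :
  a \is a GRing.unit -> v (Zp_scal D a) = 0.
Proof.
move=> ua; have a0 : a != 0 by apply: contraTneq ua => ->; rewrite unitr0.
have b0 : a^-1 != 0 by rewrite invr_eq0.
have aV : Zp_scal D a * Zp_scal D a^-1 = 1.
  by rewrite -Zp_scalM mulrV // Zp_scal1.
have [a0' b0'] : Zp_scal D a != 0 /\ Zp_scal D a^-1 != 0.
  by split; apply: contraTneq (oner_neq0 D) => e0; rewrite -aV e0 ?mul0r ?mulr0 eqxx.
apply/eqP; rewrite eq_le (valuation_Zp vP) // andbT.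
rewrite -[v _]addr0 -[X in _ <= X]v1 -aV (valuationM vP) // lerD2l.
exact: (valuation_Zp vP).
Qed.

Lemma Zp_scal_neq0 (a : padic_int p_pr) : a != 0 -> Zp_scal D a != 0.
Proof. by move=> a0; rewrite scaler_eq0 oner_eq0 orbF tofrac_eq0. Qed.

Lemma Zp_scalMn k : Zp_scal D k%:R = k%:R.
Proof.
by rewrite /Zp_scal /Zp_to_Qp (tofracMn _ (1 : padic_int p_pr)) scaler_nat.
Qed.

Lemma Zp_scalX (a : padic_int p_pr) k : Zp_scal D (a ^+ k) = Zp_scal D a ^+ k.
Proof. by elim: k => [|k IH]; rewrite ?Zp_scal1 // !exprS Zp_scalM IH. Qed.

Lemma Dp_neq0 : p%:R != 0 :> D.
Proof. by rewrite -Zp_scalMn Zp_scal_neq0 ?padic_p_neq0. Qed.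

Lemma v_Zp_int (a : padic_int p_pr) : a != 0 -> v (Zp_scal D a) \is a Num.int.
Proof.
move=> /padic_factor[k [b [-> ub]]]; rewrite Zp_scalM Zp_scalX Zp_scalMn.
have b0 : b != 0 by apply: contraTneq ub => ->; rewrite unitr0.
rewrite (valuationM vP) ?Dexpf_neq0 ?Dp_neq0 ?Zp_scal_neq0 //.
by rewrite vX ?Dp_neq0 // (valuation_p vP) mulr1 v_Zp_unit // addr0 natr_int.
Qed.

Lemma v_Qp_int (a : padic p_pr) : a != 0 -> v a%:A \is a Num.int.
Proof.
move=> a0; have [b [c [c0 ca]]] := fraction_tofrac a.
have b0 : b != 0.
  apply: contraNneq a0 => b0; move/eqP: ca; rewrite b0 tofrac0 mulf_eq0.
  by rewrite tofrac_eq0 (negPf c0).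
have ca' : Zp_scal D c * a%:A = Zp_scal D b.
  by rewrite /Zp_scal -scalerAl mul1r scalerA /Zp_to_Qp ca.
have a0' : a%:A != 0 :> D by rewrite scaler_eq0 oner_eq0 orbF.
have -> : v a%:A = v (Zp_scal D b) - v (Zp_scal D c).
  by rewrite -ca' (valuationM vP) ?Zp_scal_neq0 // addrC addKr.
by rewrite rpredB ?v_Zp_int.
Qed.

End Valuation.

(** * The order Z_p(F0) *)

Section ZpOrder.

Variables (p : nat) (p_pr : prime p) (D : falgType (padic p_pr)).
Variable F : abelian_subgroup D.

Definition Zp_order_pred : {pred D} := fun x => `[< gen_algebra (@Zp_set p p_pr) F x >].

Lemma Zp_order_closed : subring_closed Zp_order_pred.
Proof.
have [S1 SB SM _] := gen_algebra_subalgebra (@Zp_set p p_pr) F.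
split=> [|x y /asboolP Sx /asboolP Sy|x y /asboolP Sx /asboolP Sy]; apply/asboolP => //.
  exact: SB.
exact: SM.
Qed.

HB.instance Definition _ := GRing.isSubringClosed.Build D Zp_order_pred Zp_order_closed.

(** Z_p(F) becomes a commutative ring of its own, so that divisibility asks for a quotient in Z_p(F)
    and not merely in D. *)
Record Zp_order := ZpOrder { order_val :> D; order_valP : order_val \in Zp_order_pred }.

HB.instance Definition _ := [isSub for order_val].
HB.instance Definition _ := [Choice of Zp_order by <:].
HB.instance Definition _ := [SubChoice_isSubNzRing of Zp_order by <:].

Lemma order_mulC : @commutative Zp_order Zp_order *%R.
Proof.
move=> x y; apply: val_inj; rewrite !rmorphM.
exact: gen_algebra_comm (asboolW (order_valP x)) (asboolW (order_valP y)).
Qed.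

HB.instance Definition _ := GRing.PzRing_hasCommutativeMul.Build Zp_order order_mulC.

Implicit Types x y : Zp_order.

Lemma orderP x : gen_algebra (@Zp_set p p_pr) F (order_val x).
Proof. exact/asboolP/order_valP. Qed.

Lemma orderB x y : order_val (x - y) = order_val x - order_val y.
Proof. by []. Qed.

Lemma orderM x y : order_val (x * y) = order_val x * order_val y.
Proof. by []. Qed.

Lemma orderX x k : order_val (x ^+ k) = order_val x ^+ k.
Proof. exact: (rmorphXn (val : {rmorphism Zp_order -> D})). Qed.

Lemma orderMn k : order_val k%:R = k%:R.
Proof. exact: (rmorph_nat (val : {rmorphism Zp_order -> D})). Qed.

Lemma order_scal_subproof (a : padic_int p_pr) : Zp_scal D a \in Zp_order_pred.
Proof.
apply/asboolP; have [S1 _ _ SZ] := gen_algebra_subalgebra (@Zp_set p p_pr) F.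
by apply: SZ => //; exists a.
Qed.

Definition order_scal a : Zp_order := ZpOrder (order_scal_subproof a).

Lemma order_scalB a b : order_scal (a - b) = order_scal a - order_scal b.
Proof. by apply: val_inj; rewrite /= Zp_scalB. Qed.

Lemma order_scalD a b : order_scal (a + b) = order_scal a + order_scal b.
Proof. by apply: val_inj; rewrite /= /Zp_scal /Zp_to_Qp tofracD scalerDl. Qed.

Lemma order_scalM a b : order_scal (a * b) = order_scal a * order_scal b.
Proof. by apply: val_inj; rewrite /= Zp_scalM. Qed.

Lemma order_scalX a k : order_scal (a ^+ k) = order_scal a ^+ k.
Proof. by apply: val_inj; rewrite /= orderX Zp_scalX. Qed.

Lemma order_scalMn k : order_scal k%:R = k%:R.
Proof. by apply: val_inj; rewrite /= orderMn Zp_scalMn. Qed.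

(** Scaling by Z_p amounts to multiplication by some [order_scal a], so only the generators, the
    scalars and the ring operations have to be examined. *)
Lemma order_ind (P : Zp_order -> Prop) :
  (forall g, absub_set F (order_val g) -> P g) -> P 1 ->
  (forall x y, P x -> P y -> P (x - y)) ->
  (forall x y, P x -> P y -> P (x * y)) ->
  (forall a, P (order_scal a)) -> forall x, P x.
Proof.
move=> PF P1 PB PM PZ.
suff sub : gen_algebra (@Zp_set p p_pr) F `<=` [set z | exists2 x, order_val x = z & P x].
  by move=> x; have [y /val_inj <-] := sub _ (orderP x).
apply: smallest_sub => [|g Fg] /=; last first.
  have gP : g \in Zp_order_pred by apply/asboolP; exact: sub_gen_smallest.
  by exists (ZpOrder gP) => //; exact: PF.
split=> [|_ _ [x <- Px] [y <- Py]|_ _ [x <- Px] [y <- Py]|_ _ [a _ <-] [x <- Px]].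
- by exists 1.
- by exists (x - y) => //; exact: PB.
- by exists (x * y) => //; exact: PM.
- exists (order_scal a * x); last exact: PM.
  by rewrite orderM /= /Zp_scal -scalerAl mul1r.
Qed.

Lemma order_dvd_fermat a k : dvdr p%:R (order_scal a ^+ (p ^ k) - order_scal a).
Proof.
elim: k => [|k IH]; first by rewrite expr1 subrr; exact: dvdr0.
rewrite expnSr exprM; apply: dvdr_sub_trans (dvdr_subX p IH) _.
have [b ab] := padic_fermat a.
by exists (order_scal b); rewrite -order_scalX -order_scalB ab order_scalM order_scalMn.
Qed.

Section Congruences.

Variable q k : nat.
Hypothesis qE : q = (p ^ k)%N.

(** The q-th power map is additive modulo p, so the x satisfying the congruence form a subring. It
    contains F by hypothesis and the scalars by Fermat's little theorem. *)
Lemma order_frobenius_iter :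
  (forall g, absub_set F g -> g ^+ (q * q) = g ^+ q) ->
  forall x, dvdr p%:R (x ^+ q ^+ q - x ^+ q).
Proof.
move=> Fq; have qqE : (q * q = p ^ (k + k))%N by rewrite expnD qE.
have frobB x y : dvdr p%:R ((x - y) ^+ q - (x ^+ q - y ^+ q)).
  by rewrite qE; exact: dvdr_frobeniusB.
apply: order_ind => [g Fg||x y Px Py|x y Px Py|a].
- suff -> : g ^+ q ^+ q = g ^+ q by rewrite subrr; exact: dvdr0.
  by apply: val_inj; rewrite -exprM /= !orderX Fq.
- by rewrite !expr1n subrr; exact: dvdr0.
- apply: (@dvdr_sub_trans _ _ ((x ^+ q - y ^+ q) ^+ q)).
    exact: dvdr_subX.
  apply: (@dvdr_sub_trans _ _ (x ^+ q ^+ q - y ^+ q ^+ q)) => //.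
  apply: (@dvdr_sub_trans _ _ (x ^+ q - y ^+ q)); last exact: dvdr_subC.
  by rewrite addrBBA; exact: dvdrB.
- by rewrite !exprMn; exact: dvdr_subM.
- rewrite -exprM qqE; apply: dvdr_sub_trans (order_dvd_fermat _ _) _.
  by rewrite qE; exact/dvdr_subC/order_dvd_fermat.
Qed.

(** As pi divides p, the q-th power map is additive modulo pi as well, and the same subring argument
    applies. *)
Lemma order_frobenius_mod (pi : Zp_order) : dvdr pi p%:R ->
  (forall g, absub_set F (order_val g) -> dvdr pi (g ^+ q - g)) ->
  forall x, dvdr pi (x ^+ q - x).
Proof.
move=> pip Fpi; have frobB x y : dvdr pi ((x - y) ^+ q - (x ^+ q - y ^+ q)).
  by rewrite qE; exact: dvdr_trans pip (dvdr_frobeniusB _ _ _ _).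
apply: order_ind => [g Fg||x y Px Py|x y Px Py|a]; first exact: Fpi.
- by rewrite expr1n subrr; exact: dvdr0.
- apply: dvdr_sub_trans (frobB _ _) _.
  by rewrite addrBBA; exact: dvdrB.
- by rewrite exprMn; exact: dvdr_subM.
- by rewrite qE; exact: dvdr_trans pip (order_dvd_fermat _ _).
Qed.

End Congruences.

End ZpOrder.

Lemma absubX (R : unitRingType) (F : abelian_subgroup R) g i :
  absub_set F g -> absub_set F (g ^+ i).
Proof.
move=> Fg; elim: i => [|i IH]; first by rewrite expr0; exact: absub1.
by rewrite exprS; exact: absubM.
Qed.

Lemma finite_subgroup_exponent (R : unitRingType) (F : abelian_subgroup R) :
  finite_set F -> exists2 N, (0 < N)%N & forall g, absub_set F g -> g ^+ N = 1.
Proof.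
move=> /finite_seqP[s Fs].
have ord g : absub_set F g -> exists2 N, (0 < N)%N & g ^+ N = 1.
  (* Pigeonhole: there is one power more than there are entries in [s], so two powers of g
     coincide. *)
  move=> Fg; pose t := [seq g ^+ i | i <- iota 0 (size s).+1].
  have sub : {subset t <= s}.
    by move=> _ /mapP[i _ ->]; have := absubX i Fg; rewrite Fs.
  have : ~~ uniq t.
    apply/negP => /uniq_leq_size/(_ sub).
    by rewrite size_map size_iota ltnn.
  move=> /(uniqPn 0)[i [j [ij]]]; rewrite size_map size_iota => js.
  rewrite !(nth_map 0%N) ?size_iota ?(ltn_trans ij) // !nth_iota ?(ltn_trans ij) //.
  rewrite !add0n => gij; exists (j - i)%N; first by rewrite subn_gt0.
  have ug := absub_unit (absubX i Fg).
  by apply: (mulIr ug); rewrite -exprD subnK ?(ltnW ij) // mul1r.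
have sF : forall g, g \in s -> absub_set F g by move=> g gs; rewrite Fs.
have [N N0 sN] : exists2 N, (0 < N)%N & forall g, g \in s -> g ^+ N = 1.
  elim: s {Fs} sF => [|g s IH] sF; first by exists 1.
  have [|N N0 sN] := IH; first by move=> h hs; apply: sF; rewrite inE hs orbT.
  have [M M0 gM] := ord g (sF g (mem_head g s)).
  exists (M * N)%N; first by rewrite muln_gt0 M0.
  move=> h; rewrite inE => /predU1P[->|hs]; first by rewrite exprM gM expr1n.
  by rewrite mulnC exprM sN // expr1n.
by exists N => // g; rewrite Fs; exact: sN.
Qed.

(** * p-adic completeness of Z_p(F) *)

Section Completeness.

Variables (p : nat) (p_pr : prime p) (D : falgType (padic p_pr)).
Variable F : abelian_subgroup D.
Hypothesis F_fin : finite_set F.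

Local Notation Rf := (Zp_order F).

(** F is closed under multiplication, so its Z_p-span is already a ring. *)
Lemma order_span : exists s : seq Rf,
  forall x, exists c : Rf -> padic_int p_pr, x = \sum_(g <- s) order_scal F (c g) * g.
Proof.
have /finite_seqP[s0 Fs0] : finite_set F := F_fin.
have gP g : absub_set F g -> g \in Zp_order_pred F.
  by move=> Fg; apply/asboolP; exact: sub_gen_smallest.
(* Coefficients are indexed by elements and not by positions, so the list must be free of
   repetitions for the indicator function of g to yield g. *)
have [s [s_uniq sP]] : exists s : seq Rf, uniq s /\ forall g, g \in s <-> absub_set F (order_val g).
  exists (undup (pmap insub s0)); split; first exact: undup_uniq.
  move=> g; rewrite mem_undup mem_pmap_sub Fs0.
  by split.
pose span x := exists c : Rf -> padic_int p_pr, x = \sum_(g <- s) order_scal F (c g) * g.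
have spanB x y : span x -> span y -> span (x - y).
  move=> [c ->] [d ->]; exists (fun g => c g - d g); rewrite -sumrB.
  by apply: eq_bigr => g _; rewrite order_scalB mulrBl.
have span0 : span 0.
  exists (fun=> 0); rewrite big1 // => g _.
  by rewrite -[0](subrr 0) order_scalB subrr mul0r.
have spanD x y : span x -> span y -> span (x + y).
  by move=> sx sy; have := spanB x (0 - y) sx (spanB 0 y span0 sy); rewrite sub0r opprK.
have spanZ a x : span x -> span (order_scal F a * x).
  move=> [c ->]; exists (fun g => a * c g); rewrite mulr_sumr.
  by apply: eq_bigr => g _; rewrite order_scalM mulrA.
have spanF g : absub_set F (order_val g) -> span g.
  move=> /sP gs; exists (fun h => (h == g)%:R).
  rewrite (bigD1_seq g) //= eqxx order_scalMn mul1r big1 ?addr0 // => h /negPf ->.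
  by rewrite order_scalMn mul0r.
have spanFM g x : absub_set F (order_val g) -> span x -> span (g * x).
  move=> Fg [c ->]; rewrite mulr_sumr big_seq; elim/big_ind: _ => // h /sP Fh.
  by rewrite mulrCA; apply/spanZ/spanF; exact: absubM.
exists s; apply: order_ind => //.
- by apply: spanF; exact: absub1.
- move=> _ y [c ->] sy; rewrite mulr_suml big_seq; elim/big_ind: _ => // h /sP Fh.
  by rewrite -mulrA; exact/spanZ/spanFM.
- by move=> a; rewrite -[order_scal F a]mulr1; apply/spanZ/spanF; exact: absub1.
Qed.

(** The coefficients along the finite spanning family are summed separately in Z_p. *)
Lemma order_complete (r : nat -> Rf) :
  exists x, forall N, dvdr (p%:R ^+ N) (x - \sum_(k < N) p%:R ^+ k * r k).
Proof.
have [s span] := order_span.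
have [c rc] := choice (fun k => span (r k)).
have [a aP] := choice (fun g => padic_complete (fun k => c k g)).
exists (\sum_(g <- s) order_scal F (a g) * g) => N.
have -> : \sum_(k < N) p%:R ^+ k * r k =
    \sum_(g <- s) order_scal F (\sum_(k < N) p%:R ^+ k * c k g) * g.
  under eq_bigr => k _ do rewrite rc mulr_sumr.
  rewrite exchange_big; apply: eq_bigr => g _ /=.
  have -> : order_scal F (\sum_(k < N) p%:R ^+ k * c k g) =
      \sum_(k < N) p%:R ^+ k * order_scal F (c k g).
    elim: N => [|N IH]; first by rewrite !big_ord0 (order_scalMn F 0).
    by rewrite !big_ord_recr /= order_scalD IH order_scalM order_scalX order_scalMn.
  by rewrite mulr_suml; apply: eq_bigr => k _; rewrite mulrA.
rewrite -sumrB; apply: dvdr_sum => g _.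
rewrite -mulrBl -order_scalB; apply: dvdr_mulr.
have [b ->] := aP g N; exists (order_scal F b).
by rewrite order_scalM order_scalX order_scalMn.
Qed.

End Completeness.

(** * Integral closedness of Z_p(F0) *)

Section Integrality.

Variables (p : nat) (p_pr : prime p) (D : falgType (padic p_pr)).
Variables (n : nat) (v : D -> rat).
Hypothesis n_gt0 : (0 < n)%N.
Hypothesis D_div : forall x : D, x != 0 -> x \is a GRing.unit.
Hypothesis vP : is_valuation n v.
Variable F : abelian_subgroup D.
Hypothesis F_fin : finite_set F.

Local Notation Rf := (Zp_order F).

(** Elements of F are roots of unity and have valuation 0, and scalars from Z_p have nonnegative
    valuation. *)
Lemma order_val_ge0 (x : Rf) : val_ge v 0 (order_val x).
Proof.
have [N N0 FN] := finite_subgroup_exponent F_fin.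
move: x; apply: order_ind => [g Fg||x y|x y|a].
- by right; rewrite (v_root1 D_div vP N0 (FN _ Fg)).
- by right; rewrite (v1 vP).
- exact: (val_geB D_div vP).
- by rewrite -{3}[0]addr0; exact: (val_geM vP).
- have [->|a0] := eqVneq a 0; first by left; rewrite /= /Zp_scal /Zp_to_Qp tofrac0 scale0r.
  by right; exact: (valuation_Zp vP).
Qed.

(** The values of [v] lie in (1/n)Z, so the positive ones are bounded away from 0. This bounds from
    below the growth of the valuations of powers. *)
Lemma v_ge_inv x : x != 0 -> 0 < v x -> n%:R^-1 <= v x.
Proof.
move=> x0 vx0; have n0 : (0 : rat) < n%:R by rewrite ltr0n.
rewrite -div1r ler_pdivrMr // mulrC.
have /intrP[m vm] := valuation_range vP x0.
by move: (mulr_gt0 n0 vx0); rewrite vm ltr0z ler1z.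
Qed.

(** Completeness provides the candidate x for y / p inside Z_p(F); the equality y = p x is then
    checked by valuations in D. *)
Lemma order_frobenius_fixed q k (y : Rf) : q = (p ^ k)%N -> (0 < k)%N ->
  dvdr p%:R (y ^+ q - y) -> order_val y != 0 -> 0 < v (order_val y) ->
  dvdr p%:R y.
Proof.
move=> qE k0 yq y0 vy.
(* Raising y = y^q modulo p to the p^(k i)-th power gives a congruence modulo p^(k i + 1), and k i +
   1 is at least i + 1 as k > 0. *)
have Ystep i : dvdr (p%:R ^+ i.+1) (y ^+ (q ^ i) - y ^+ (q ^ i.+1)).
  rewrite expnS exprM; apply: (@dvdr_expl _ _ _ _ (k * i).+1).
    by rewrite ltnS leq_pmull.
  by rewrite qE -expnM; apply/dvdr_expp => //; rewrite -qE; exact/dvdr_subC.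
have [r rP] := choice Ystep.
have [x xP] := order_complete F_fin r.
exists x; apply: val_inj; apply/eqP; rewrite -subr_eq0; apply/eqP.
(* The factor n in N compensates v(y) >= 1/n: the valuation of y^(q^N) is at least q^N / n, which
   exceeds N / n = M. *)
apply: val_ge_eq0 => M; pose N := (M * n)%N.
have [t xt] := xP N.
(* Telescoping sum of the differences of consecutive y^(q^i). *)
have -> : y = \sum_(i < N) p%:R ^+ i.+1 * r i + y ^+ (q ^ N).
  elim: N {xt} => [|N IH]; first by rewrite big_ord0 add0r expr1.
  by rewrite big_ord_recr /= {1}IH -rP -addrA subrK.
have -> : p%:R * x = \sum_(i < N) p%:R ^+ i.+1 * r i + p%:R ^+ N.+1 * t.
  rewrite exprS -mulrA -xt mulrBr mulr_sumr.
  under [X in _ - X]eq_bigr => i _ do rewrite mulrA -exprS.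
  by rewrite addrC subrK.
rewrite [\val _ - \val _](_ : _ = order_val (y ^+ (q ^ N) - p%:R ^+ N.+1 * t)); last first.
  rewrite -[LHS]/(order_val (_ - _)); congr order_val; ring.
rewrite orderB; apply: (val_geB D_div vP) => //.
  rewrite orderX; apply: (val_ge_le (d := (q ^ N)%:R * n%:R^-1)).
    rewrite ler_pdivlMr ?ltr0n // -natrM ler_nat -/N ltnW // ltn_expl //.
    by rewrite qE -(exp1n k) ltn_exp2r // prime_gt1.
  apply: (val_geX vP) => //; right; exact: v_ge_inv.
rewrite orderM -[M%:R]addr0; apply: (val_geM vP) => //; last exact: order_val_ge0.
rewrite orderX orderMn; apply: (val_ge_le (d := N.+1%:R * 1)).
  by rewrite mulr1 ler_nat (leq_trans (leq_pmulr M n_gt0)).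
by apply: (val_geX vP) => //; right; rewrite (valuation_p vP).
Qed.

(** Over a division ring a polynomial may have more roots than its degree, but not if they commute
    pairwise. If g were no power of z, then g and the m powers of z would be m + 1 commuting roots
    of X^m - 1. *)
Lemma primitive_root_powers (z g : D) m : m.-primitive_root z -> g ^+ m = 1 ->
  z * g = g * z -> exists i, g = z ^+ i.
Proof.
move=> z_prim gm zg; apply: contrapT => g_nz.
pose rs := g :: [seq z ^+ i | i <- iota 0 m].
have m_gt0 := prim_order_gt0 z_prim.
suff : (size rs < size ('X^m - 1 : {poly D})%R)%N.
  by rewrite /= size_map size_iota size_XnsubC // ltnn.
have rsX x : x \in rs -> x = g \/ exists i, x = z ^+ i.
  by rewrite inE => /predU1P[|/mapP[i _]]; [left|right; exists i].
apply: max_ring_poly_roots.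
- by rewrite -size_poly_eq0 size_XnsubC.
- apply/allP => x /rsX xrs; rewrite /root !hornerE hornerXn.
  case: xrs => [->|[i ->]]; first by rewrite gm subrr.
  by rewrite exprAC (prim_expr_order z_prim) expr1n subrr.
have : {in rs &, forall x y, x * y = y * x}.
  move=> x y /rsX[->|[i ->]] /rsX[->|[j ->]] //.
  - exact/commrX/esym.
  - exact/commr_sym/commrX/esym.
  - exact/commrX/commr_sym/commrX.
have : uniq rs.
  rewrite /= map_inj_in_uniq ?iota_uniq ?andbT.
    by apply/mapP => -[i _ gi]; apply: g_nz; exists i.
  move=> i j; rewrite !mem_iota !add0n /= => im jm /eqP.
  by rewrite (eq_prim_root_expr z_prim) !modn_small // => /eqP.
elim: rs {rsX} => //= x s IH /andP[xs s_uniq] s_comm.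
apply/andP; split; last first.
  by apply: IH => // y t ys ts; apply: s_comm; rewrite inE ?ys ?ts orbT.
apply/allP => y ys; rewrite /diff_roots s_comm ?inE ?eqxx ?ys ?orbT //=.
by rewrite D_div // subr_eq0; apply: contraNneq xs => <-.
Qed.

(** The elements of F killed by p^b form a cyclic group; pi is 1 - z for a generator z, or p if the
    group is trivial. Any g in the group is some z^i, and 1 - z divides 1 - z^i. *)
Lemma order_uniformizer b : exists pi : Rf,
  [/\ dvdr pi p%:R, exists M, dvdr p%:R (pi ^+ M) &
    forall g : Rf, absub_set F (order_val g) -> g ^+ (p ^ b) = 1 -> dvdr pi (1 - g)].
Proof.
pose P (g : Rf) := absub_set F (order_val g) /\ g ^+ (p ^ b) = 1.
pose killed j := `[< forall g, P g -> g ^+ (p ^ j) = 1 >].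
have ex_killed : exists j, killed j by exists b; apply/asboolP => g [].
(* The least power p^j killing this group is considered. For exponent 0 the group is trivial and pi
   = p works; otherwise the exponent is renamed [j.+1]. *)
case: (ex_minnP ex_killed) => -[|j] /asboolP Pj j_min.
  exists p%:R; split; [exact: dvdrr|by exists 1; exact: dvdrr|].
  by move=> g Fg gb; rewrite -(Pj g) // expr1 subrr; exact: dvdr0.
have [z [Fz zb] zj] : exists2 z, P z & z ^+ (p ^ j) <> 1.
  apply: contrapT => nz; suff : (j < j)%N by rewrite ltnn.
  apply: j_min; apply/asboolP => g Pg; apply: contrapT => gj.
  by apply: nz; exists g.
have zj1 : z ^+ (p ^ j.+1) = 1 by exact: Pj.
have zj1' : order_val z ^+ (p ^ j.+1) = 1 by rewrite -orderX zj1.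
(* The order of z is a power of p dividing p^(j+1); a smaller one would divide p^j, contrary to the
   choice of z. *)
have z_prim : (p ^ j.+1).-primitive_root (order_val z).
  have [|m m_prim] := prim_order_exists (_ : 0 < p ^ j.+1)%N zj1'.
    by rewrite expn_gt0 prime_gt0.
  move=> /(dvdn_pfactor _ _ p_pr)[l lj mE]; move: m_prim; rewrite mE.
  have [->//|ljn] := eqVneq l j.+1.
  have {}lj : (l <= j)%N by rewrite -ltnS ltn_neqAle ljn.
  move=> /prim_expr_order zl; case: zj; apply: val_inj.
  by rewrite /= orderX -(subnKC lj) expnD exprM zl expr1n.
exists (1 - z); split.
- apply: (dvdr_root_of_unity_p _ zj1).
    move=> x y /(congr1 val) /= /(Dmulf_eq0 D_div)[x0|y0].
      by left; apply: val_inj.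
    by right; apply: val_inj.
  by move=> z1; apply: zj; rewrite z1 expr1n.
- by exists (p ^ j.+1)%N; exact: dvdr_p_sub1X.
move=> g Fg gb; have [|i gi] := primitive_root_powers z_prim _ (absubC Fz Fg).
  by have := congr1 val (Pj g (conj Fg gb)); rewrite /= orderX.
have -> : g = z ^+ i by apply: val_inj; rewrite /= orderX.
exact: dvdr_sub1X.
Qed.

Lemma order_val_dvd : exists pi : Rf,
  [/\ pi <> 0, exists M, dvdr p%:R (pi ^+ M) &
    forall x, order_val x != 0 -> 0 < v (order_val x) -> dvdr pi x].
Proof.
have [N N0 FN] := finite_subgroup_exponent F_fin.
(* The integer N, which kills F, splits as m p^b with m prime to p. *)
have [m pm NE] := pfactor_coprime p_pr N0; set b := logn p N in NE.
have m0 : (0 < m)%N by move: N0; rewrite NE muln_gt0 => /andP[].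
have [pi [pi_p pi_M pi_F]] := order_uniformizer b.
exists pi; split=> //.
  move=> pi0; case: pi_p => r; rewrite pi0 mul0r => /(congr1 val)/eqP.
  by rewrite /= orderMn (negPf (Dp_neq0 _)).
(* Euler's theorem gives m | q - 1, and k >= b gives p^b | q, so N divides q (q - 1). The factor
   [b.+1] in place of b keeps k positive. *)
pose k := (b.+1 * totient m)%N; pose q := (p ^ k)%N.
have k0 : (0 < k)%N by rewrite muln_gt0 totient_gt0.
have q0 : (0 < q)%N by rewrite expn_gt0 prime_gt0.
have m_dvd : (m %| q - 1)%N.
  rewrite -eqn_mod_dvd // /q /k mulnC expnM -modnXm.
  by rewrite cyclic.Euler_exp_totient ?modnXm ?exp1n // coprime_sym.
have Fq g : absub_set F g -> g ^+ (q * q) = g ^+ q.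
  move=> Fg; have /dvdnP[t qt] : (N %| q * (q - 1))%N.
    rewrite NE mulnC dvdn_mul // /q dvdn_exp2l //.
    by rewrite (leq_trans (leqnSn b)) // leq_pmulr // totient_gt0.
  have -> : (q * q = q + t * N)%N.
    by rewrite -qt mulnBr muln1 subnKC // leq_pmulr.
  by rewrite exprD mulnC exprM FN // expr1n mulr1.
have qk : q = (p ^ k)%N by [].
have xqx : forall x : Rf, dvdr pi (x ^+ q - x).
  apply: (order_frobenius_mod qk pi_p) => g Fg.
  (* As m divides q - 1, the element g^(q-1) of F is killed by p^b, so pi divides 1 - g^(q-1). *)
  have -> : g ^+ q = g * g ^+ (q - 1) by rewrite -exprS -addn1 subnK.
  rewrite -[X in _ - X]mulr1 -mulrBr; apply/dvdr_mull/dvdr_subC/pi_F.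
    by rewrite orderX; exact: absubX.
  have /dvdnP[t qt] : (N %| (q - 1) * p ^ b)%N by rewrite NE dvdn_mul.
  by rewrite -exprM qt mulnC exprM; apply: val_inj; rewrite /= !orderX FN ?expr1n.
(* The power x^q is fixed by the q-th power map modulo p and has positive valuation, so p divides
   it. Since x = x^q modulo pi, also pi divides x. *)
move=> x x0 vx; have := order_frobenius_iter qk Fq x.
move=> /(order_frobenius_fixed qk k0) pxq.
have {}pxq : dvdr p%:R (x ^+ q).
  apply: pxq; rewrite orderX ?Dexpf_neq0 // (vX D_div vP) //.
  by rewrite mulr_gt0 // ltr0n.
have := dvdrB (dvdr_trans pi_p pxq) (xqx x).
by rewrite opprB addrC subrK.
Qed.

End Integrality.

(** * Z_p(F) as the valuation ring of Q_p(F) *)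

Section IntegersOfQpF.

Variables (p : nat) (p_pr : prime p) (D : falgType (padic p_pr)).
Variables (n : nat) (v : D -> rat).
Hypothesis n_gt0 : (0 < n)%N.
Hypothesis D_div : forall x : D, x != 0 -> x \is a GRing.unit.
Hypothesis vP : is_valuation n v.
Variable F : abelian_subgroup D.
Hypothesis F_fin : finite_set F.

Local Notation Rf := (Zp_order F).

Lemma Qp_algebra_denom x : gen_algebra setT F x ->
  exists N (z : Rf), order_val z = p%:R ^+ N * x.
Proof.
move: x; apply: smallest_sub => [|g Fg] /=; last first.
  have gP : g \in Zp_order_pred F by apply/asboolP; exact: sub_gen_smallest.
  by exists 0, (ZpOrder gP); rewrite mul1r.
have pC k (x : D) : x * p%:R ^+ k = p%:R ^+ k * x by exact/commrX/commr_nat.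
split=> [|x y [N [z zx]] [M [t ty]]|x y [N [z zx]] [M [t ty]]|a x _ [N [z zx]]].
- by exists 0, 1; rewrite mul1r.
- exists (N + M)%N, (z * p%:R ^+ M - t * p%:R ^+ N).
  rewrite orderB !orderM !orderX orderMn zx ty mulrBr.
  by rewrite -[_ * x * _]mulrA -[_ * y * _]mulrA !pC !mulrA -!exprD addnC.
- exists (N + M)%N, (z * t); rewrite orderM zx ty exprD -!mulrA.
  by congr (_ * _); rewrite !mulrA pC.
(* With a = b / c and c = p^k d for a unit d, the multiple p^k a = b / d is a p-adic integer. *)
have [b [c [c0 ca]]] := fraction_tofrac a.
have [k [d [cE ud]]] := padic_factor c0.
have aE : Zp_to_Qp (d^-1 * b) = p%:R ^+ k * a.
  rewrite /Zp_to_Qp tofracM -ca cE mulrA -tofracM mulrCA mulVr // mulr1.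
  by rewrite tofracXn (tofracMn _ (1 : padic_int p_pr)).
have scalE : (p%:R ^+ k * a)%:A = p%:R ^+ k * a%:A :> D.
  by rewrite -[LHS]/(in_alg D _) rmorphM rmorphXn rmorph_nat.
exists (k + N)%N, (order_scal F (d^-1 * b) * z).
rewrite orderM /= zx /Zp_scal aE scalE exprD -!mulrA.
by rewrite mulr_algl scalerAr.
Qed.

Lemma Qp_val_ge0_integral x : gen_algebra setT F x -> x != 0 -> 0 <= v x ->
  gen_algebra (@Zp_set p p_pr) F x.
Proof.
move=> /Qp_algebra_denom[N [z zx]] x0 vx.
have [pi [pi0 [M [r pi_M]] pi_dvd]] := order_val_dvd n_gt0 D_div vP F_fin.
have piD0 : order_val pi != 0.
  by apply/eqP => e; apply: pi0; apply: val_inj.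
have piE : order_val pi ^+ M = p%:R * order_val r.
  by rewrite -orderX pi_M orderM orderMn.
(* Indeed pi^M = p r has valuation at least 1. *)
have vpi : 0 < v (order_val pi).
  have r0 : order_val r != 0.
    apply: contraTneq (Dexpf_neq0 D_div M piD0) => r0.
    by rewrite piE r0 mulr0 eqxx.
  have : 0 < M%:R * v (order_val pi).
    rewrite -(vX D_div vP) // piE (valuationM vP) ?Dp_neq0 // (valuation_p vP).
    have [/eqP|vr] := order_val_ge0 D_div vP F_fin r; first by rewrite (negPf r0).
    by rewrite ltr_wpDr.
  by case: M {piE pi_M} => [|M]; rewrite ?mul0r ?ltxx // pmulr_rgt0.
(* The element pi^(M N) x = r^N p^N x = r^N z lies in Z_p(F). Its factors pi are cancelled one at a
   time: while one is left the valuation is positive, so division by pi stays in Z_p(F). *)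
have : order_val (r ^+ N * z) = order_val pi ^+ (M * N) * x.
  rewrite orderM orderX zx exprM piE exprMn_comm; last exact/commr_sym/commr_nat.
  rewrite mulrA; congr (_ * _); exact/commrX/commr_nat.
elim: (M * N)%N (r ^+ N * z) => [|k IH] t tx.
  by rewrite -[x]mul1r -[_ * _]tx; exact: orderP.
have t0 : order_val t != 0 by rewrite tx Dmulf_neq0 ?Dexpf_neq0.
have [|t' tE] := pi_dvd t t0.
  rewrite tx (valuationM vP) ?Dexpf_neq0 // (vX D_div vP) //.
  by rewrite ltr_wpDr // mulr_gt0 // ltr0n.
apply: (IH t'); apply: (mulrI (D_div piD0)).
by rewrite mulrA -exprS -tx tE.
Qed.

End IntegersOfQpF.

(** * Value groups *)

Section Subgroups.

Variable R : unitRingType.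
Implicit Types (X Y : set R) (x y : R).

Lemma is_subgroupV X x : is_subgroup X -> X x -> X x^-1.
Proof. by move=> [_ X1 XD] Xx; rewrite -div1r; exact: XD. Qed.

Lemma is_subgroupM X x y : is_subgroup X -> X x -> X y -> X (x * y).
Proof.
move=> sX Xx Xy; rewrite -[y]invrK.
by case: (sX) => _ _; apply=> //; exact: is_subgroupV.
Qed.

Lemma is_subgroupZ X x (k : int) : is_subgroup X -> X x -> X (x ^ k).
Proof.
move=> sX Xx; have XX m : X (x ^+ m).
  elim: m => [|m IH]; first by case: sX.
  by rewrite exprS; exact: is_subgroupM.
by case: k => k; [exact: XX|rewrite NegzE -exprnN; exact: is_subgroupV].
Qed.

End Subgroups.

Section ValueGroups.

Variables (p : nat) (p_pr : prime p) (D : falgType (padic p_pr)).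
Variables (n : nat) (v : D -> rat).
Hypothesis n_gt0 : (0 < n)%N.
Hypothesis D_div : forall x : D, x != 0 -> x \is a GRing.unit.
Hypothesis vP : is_valuation n v.
Implicit Types (X Y : set D) (x y : D).

Lemma subgroup_neq0 X x : is_subgroup X -> X x -> x != 0.
Proof. by move=> [Xu _ _] /Xu; exact: unit_neq0. Qed.

Lemma v_div x y : x != 0 -> y != 0 -> v (x / y) = v x - v y.
Proof.
move=> x0 y0; rewrite (valuationM vP) ?(vV D_div vP) //.
by rewrite unit_neq0 // unitrV D_div.
Qed.

(** By Euclidean division the least positive integer m in n v(X) generates n v(X). Since v(z) = 1, n
    = m d for some d, and v(X) = (1/d)Z. *)
Lemma value_group_cyclic X z : is_subgroup X -> X z -> v z = 1 ->
  exists d x, [/\ (0 < d)%N, X x, v x = d%:R^-1 &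
    forall y, X y -> d%:R * v y \is a Num.int].
Proof.
move=> sX Xz vz; have n0 : (n%:R : rat) != 0 by rewrite pnatr_eq0 -lt0n.
pose Q m := `[< (0 < m)%N /\ exists2 x, X x & n%:R * v x = m%:R >].
have exQ : exists m, Q m.
  by exists n; apply/asboolP; split=> //; exists z; rewrite ?vz ?mulr1.
case: (ex_minnP exQ) => m /asboolP[m_gt0 [x Xx vx]] m_min.
have m0 : (m%:R : rat) != 0 by rewrite pnatr_eq0 -lt0n.
have x0 := subgroup_neq0 sX Xx.
have dvd_m y : X y -> exists k : int, n%:R * v y = m%:R * k%:~R.
  move=> Xy; have y0 := subgroup_neq0 sX Xy.
  have /intrP[j vy] := valuation_range vP y0.
  exists (j %/ m)%Z; rewrite vy {1}(divz_eq j m).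
  suff -> : (j %% m)%Z = 0 by rewrite addr0 intrM mulrC.
  have : 0 <= (j %% m)%Z by rewrite modz_ge0 // eqz_nat -lt0n.
  have : (j %% m)%Z < m by rewrite ltz_pmod // ltz_nat.
  (* The remainder is again a value of n v on X, so it is 0 by minimality of m. *)
  have jE : n%:R * v (y * x ^ (- (j %/ m)%Z)) = (j %% m)%Z%:~R.
    have xk0 : x ^ (- (j %/ m)%Z) != 0 by apply/unit_neq0/unitrXz/D_div.
    rewrite (valuationM vP) // (vZ D_div vP) // mulrDr vy mulrCA vx mulrNz.
    by rewrite mulNr {1}(divz_eq j m) intrD intrM addrAC subrr add0r.
  case: (j %% m)%Z jE => // -[//|k] jE km _; exfalso.
  suff : (m <= k.+1)%N by rewrite leqNgt; move: km; rewrite ltz_nat => ->.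
  apply: m_min; apply/asboolP; split=> //; exists (y * x ^ (- (j %/ m)%Z)) => //.
  by apply: is_subgroupM => //; exact: is_subgroupZ.
have [d nd] := dvd_m z Xz; rewrite vz mulr1 in nd.
have d_gt0 : 0 < d.
  have : (0 : rat) < m%:R * d%:~R by rewrite -nd ltr0n.
  by rewrite pmulr_rgt0 ?ltr0n // ltr0z.
case: d d_gt0 nd => // d; rewrite ltz_nat -pmulrn => d_gt0 nd.
have d0 : (d%:R : rat) != 0 by rewrite pnatr_eq0 -lt0n.
exists d, x; split=> // [|y Xy].
  by apply: (mulfI n0); rewrite vx nd mulfK.
have [k yk] := dvd_m y Xy.
suff -> : d%:R * v y = k%:~R by exact: intr_int.
by apply: (mulfI m0); rewrite mulrA -nd.
Qed.

(** A coset is determined by its valuation modulo Z, so the x^i with i < d represent all cosets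
    exactly once. *)
Lemma card_cosets X Y d x : is_subgroup X -> is_subgroup Y -> Y `<=` X ->
  (0 < d)%N -> X x -> v x = d%:R^-1 ->
  (forall y, X y -> d%:R * v y \is a Num.int) ->
  (forall y, Y y -> v y \is a Num.int) ->
  (forall y z, X y -> X z -> v y - v z \is a Num.int -> Y (y / z)) ->
  (forall y z, X y -> X z -> y * z = z * y) ->
  (cosets X Y #= `I_d)%card.
Proof.
move=> sX sY YX d_gt0 Xx vx Xint Yint inj XC.
have d0 : (d%:R : rat) != 0 by rewrite pnatr_eq0 -lt0n.
have XX i : X (x ^+ i) by exact: (is_subgroupZ i).
have x0 := subgroup_neq0 sX Xx.
have vxX i : v (x ^+ i) = i%:R / d%:R by rewrite (vX D_div vP) // vx.
have Y1 : Y 1 by case: sY.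
rewrite card_eq_sym; apply/card_set_bijP.
exists (fun i => [set x ^+ i * y | y in Y]); split.
- by move=> i _; exists (x ^+ i).
- move=> i j; rewrite !inE /= => id jd ij.
  have [y Yy xy] : [set x ^+ j * y | y in Y] (x ^+ i).
    by rewrite -ij; exists 1; rewrite ?mulr1.
  have /intrP[k vy] := Yint y Yy.
  have : (i%:R : rat) = j%:R + d%:R * k%:~R.
    apply: (mulIf (invr_neq0 d0)); rewrite -vxX -xy (valuationM vP) ?vy ?vxX.
    - by rewrite mulrDl mulrAC mulfV // mul1r.
    - exact: subgroup_neq0 (XX j).
    - exact: subgroup_neq0 (YX _ Yy).
  rewrite 3!pmulrn -intrM -intrD => /intr_inj ijk.
  have := congr1 (fun t => (t %% d)%Z) ijk.
  rewrite addrC mulrC modzMDl !modz_nat => -[].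
  by rewrite !modn_small.
(* For surjectivity, i is the remainder of d v(y) modulo d; then v(y) and v(x^i) differ by an
   integer. *)
move=> _ [y Xy <-] /=; have /intrP[m vy] := Xint y Xy.
have m_ge0 : 0 <= (m %% d)%Z by rewrite modz_ge0 // eqz_nat -lt0n.
have m_ltd : (m %% d)%Z < d by rewrite ltz_pmod // ltz_nat.
have mE := divz_eq m d.
case: (m %% d)%Z m_ge0 m_ltd mE => // i _; rewrite ltz_nat => id mE.
exists i => //.
have vyx : v y - v (x ^+ i) = (m %/ d)%Z%:~R.
  apply: (mulfI d0); rewrite vxX mulrBr vy mulrCA mulfV // mulr1 {1}mE.
  by rewrite intrD intrM mulrC -pmulrn addrK.
have ux := D_div (subgroup_neq0 sX (XX i)).
have uy := D_div (subgroup_neq0 sX Xy).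
have xyV : Y (y / x ^+ i) by apply: inj => //; rewrite vyx intr_int.
have Vxy : Y (x ^+ i / y) by apply: inj => //; rewrite -opprB rpredN vyx intr_int.
have yC : y / x ^+ i = (x ^+ i)^-1 * y.
  by apply: XC => //; exact: is_subgroupV.
apply/seteqP; split=> _ [w Yw <-] /=.
  exists (x ^+ i / y * w); first exact: is_subgroupM.
  rewrite !mulrA.
  have -> : y * x ^+ i = x ^+ i * y by exact: XC.
  by rewrite mulrK.
exists (y / x ^+ i * w); first exact: is_subgroupM.
by rewrite yC !mulrA mulrV // mul1r.
Qed.

End ValueGroups.

(** * Unit groups and the ramification index *)

Section UnitsOfQpF.

Variables (p : nat) (p_pr : prime p) (D : falgType (padic p_pr)).
Variables (n : nat) (v : D -> rat).
Hypothesis n_gt0 : (0 < n)%N.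
Hypothesis D_div : forall x : D, x != 0 -> x \is a GRing.unit.
Hypothesis vP : is_valuation n v.
Variable F : abelian_subgroup D.
Hypothesis F_fin : finite_set F.
Variables (u : padic_int p_pr) (u_unit : u \is a GRing.unit).
Implicit Types x y : D.

Local Notation E := (Qp_units F).
Local Notation Zu := (Zp_units F).
Local Notation P := (pu_group D u_unit).
Local Notation Ft := (F0_tilde F u_unit).
Local Notation pu := (pu D u).
Local Notation e := (ramification_index v F).

Lemma absub_neq0 (X : abelian_subgroup D) x : absub_set X x -> x != 0.
Proof. by move=> /absub_unit; exact: unit_neq0. Qed.

Lemma Qp_units_subgroup : is_subgroup (Qp_units F).
Proof. exact: absubP. Qed.

Lemma v_pu : v pu = 1.
Proof.
rewrite /Defs.pu Zp_scalM (valuationM vP) ?Zp_scal_neq0 ?padic_p_neq0 //.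
  by rewrite Zp_scalMn (valuation_p vP) (v_Zp_unit vP) // addr0.
by apply: contraTneq u_unit => ->; rewrite unitr0.
Qed.

Lemma pu_neq0 : pu != 0.
Proof. exact/unit_neq0/pu_unit. Qed.

Lemma v_puX (k : int) : v (pu ^ k) = k%:~R.
Proof. by rewrite (vZ D_div vP) ?pu_neq0 // v_pu mulr1. Qed.

Lemma pu_group_pu (k : int) : absub_set P (pu ^ k).
Proof. by exists k. Qed.

Lemma Qp_units_pu (k : int) : absub_set E (pu ^ k).
Proof. exact/(@pu_group_sub _ _ _ _ u_unit)/pu_group_pu. Qed.

Lemma pu_group_v x : absub_set P x -> exists k : int, x = pu ^ k /\ v x = k%:~R.
Proof. by move=> [k _ <-]; exists k; rewrite v_puX. Qed.

Lemma sub_Zp_units : F `<=` Zu.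
Proof.
move=> x Fx; split; first exact: absub_unit Fx.
  exact: sub_gen_smallest.
by apply: sub_gen_smallest; exact: (absubV Fx).
Qed.

Lemma sub_Qp_units : F `<=` E.
Proof. by move=> x /sub_Zp_units; exact: Zp_units_sub. Qed.

Lemma v_Zp_units x : absub_set Zu x -> v x = 0.
Proof.
move=> Zx; have x0 := absub_neq0 Zx.
have v_ge0 y : absub_set Zu y -> 0 <= v y.
  move=> Zy; have y0 := absub_neq0 Zy; case: Zy => _ Ry _.
  have yP : y \in Zp_order_pred F by exact/asboolP.
  case: (order_val_ge0 D_div vP F_fin (ZpOrder yP)) => [/eqP|//].
  by rewrite (negPf y0).
apply/eqP; rewrite eq_le v_ge0 // andbT -oppr_ge0 -(vV D_div vP) //.
exact/v_ge0/absubV.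
Qed.

(** Both x and its inverse have valuation 0, hence are integral. Exactness of the extension at the
    middle term rests on this. *)
Lemma v0_Zp_units x : absub_set E x -> v x = 0 -> absub_set Zu x.
Proof.
move=> Ex vx; have x0 := absub_neq0 Ex; have [ux Kx KxV] := Ex.
split=> //; apply: (Qp_val_ge0_integral n_gt0 D_div vP F_fin) => //.
- by rewrite vx.
- by rewrite unit_neq0 // unitrV.
- by rewrite (vV D_div vP) // vx oppr0.
Qed.

Lemma v_Ft x : Ft x -> v x \is a Num.int.
Proof.
move=> [f [w [Ff /pu_group_v[k [-> _]] ->]]].
rewrite (valuationM vP) ?v_puX ?(absub_neq0 Ff) ?(absub_neq0 (pu_group_pu k)) //.
by rewrite v_Zp_units ?add0r ?intr_int //; exact: sub_Zp_units.
Qed.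

Lemma Ft_pu (k : int) : Ft (pu ^ k).
Proof.
by exists 1, (pu ^ k); split; [exact: absub1|exact: pu_group_pu|rewrite mul1r].
Qed.

Lemma F_sub_Ft : F `<=` Ft.
Proof. by move=> f Ff; exists f, 1; split; [|exact: absub1|rewrite mulr1]. Qed.

Lemma Ft_sub : Ft `<=` E.
Proof.
move=> _ [f [w [Ff Pw ->]]]; apply: absubM; first exact: sub_Qp_units.
exact/(@pu_group_sub _ _ _ _ u_unit).
Qed.

Lemma Ft_subgroup : is_subgroup Ft.
Proof.
split=> [x /Ft_sub/absub_unit//||].
  by exists 1, 1; split; rewrite ?mulr1 //; exact: absub1.
move=> x y [f [w [Ff Pw ->]]] [g [t [Fg Pt ->]]].
exists (f / g), (w / t); split; [exact: absub_div|exact: absub_div|].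
have [ug ut] := (absub_unit Fg, absub_unit Pt).
have Ew := @pu_group_sub _ _ _ _ u_unit F _ Pw.
have Et := @pu_group_sub _ _ _ _ u_unit F _ Pt.
rewrite invrM // -!mulrA; congr (_ * _).
by rewrite mulrA (absubC (absub_div Ew Et) (absubV (sub_Qp_units Fg))).
Qed.

(** The valuation of f (pu)^k is k, so valuation 0 leaves only the factor f. *)
Lemma Ft_v0 x : Ft x -> v x = 0 -> absub_set F x.
Proof.
move=> [f [w [Ff /pu_group_v[k [-> _]] ->]]].
rewrite (valuationM vP) ?v_puX ?(absub_neq0 Ff) ?(absub_neq0 (pu_group_pu k)) //.
rewrite v_Zp_units ?add0r; last exact: sub_Zp_units.
by move=> /eqP; rewrite intr_eq0 => /eqP ->; rewrite mulr1.
Qed.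

(** The valuation maps the units of Q_p onto Z and those of Q_p(F) onto (1/d)Z, so the classes are
    the i/d + Z with i < d. *)
Lemma ramification_indexP : (0 < e)%N /\ exists x,
  [/\ absub_set E x, v x = e%:R^-1 &
    forall y, absub_set E y -> e%:R * v y \is a Num.int].
Proof.
have [d [x [d_gt0 Ex vx Ed]]] :=
  value_group_cyclic n_gt0 D_div vP Qp_units_subgroup (Qp_units_pu 1) (v_puX 1).
suff -> : e = d by split=> //; exists x.
(* Since [fset_set] is empty on an infinite set, an explicit bijection with the integers below d is
   given, which settles finiteness as well. *)
rewrite /ramification_index; apply: card_fset_set.
have d0 : (d%:R : rat) != 0 by rewrite pnatr_eq0 -lt0n.
have EX i : absub_set E (x ^+ i) by exact: (is_subgroupZ i Qp_units_subgroup).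
have vX i : v (x ^+ i) = i%:R / d%:R by rewrite (vX D_div vP) ?vx // (absub_neq0 Ex).
pose Qv := [set v (a%:A : D) | a in [set a : padic p_pr | a != 0]].
have QvE : Qv = [set k%:~R | k in [set: int]].
  apply/seteqP; split=> [_ [a a0 <-]|_ [k _ <-]].
    by have /intrP[k ->] := v_Qp_int D_div vP a0; exists k.
  have p0 : p%:R != 0 :> padic p_pr.
    by apply: contraNneq (Dp_neq0 D) => p0; rewrite -(scaler_nat _ (1 : D)) p0 scale0r.
  exists (p%:R ^ k); first by rewrite /= expfz_neq0.
  rewrite -[X in v X]/(in_alg D _) rmorphXz ?unitfE // rmorph_nat.
  by rewrite (vZ D_div vP) ?Dp_neq0 // (valuation_p vP) mulr1.
have imE q : [set q + v (a%:A : D) | a in [set a : padic p_pr | a != 0]] =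
    [set q + t | t in Qv].
  by rewrite [RHS]image_comp.
rewrite card_eq_sym; apply/card_set_bijP.
exists (fun i => [set i%:R / d%:R + t | t in Qv]); split.
- move=> i _; exists (v (x ^+ i)); first by exists (x ^+ i).
  by rewrite imE vX.
- move=> i j; rewrite !inE /= => id jd ij.
  have [t Qt jt] : [set j%:R / d%:R + t | t in Qv] (i%:R / d%:R).
    by rewrite -ij; exists 0; rewrite ?addr0 // QvE; exists 0.
  move: Qt; rewrite QvE => -[k _ kt].
  have : (i%:R : rat) = j%:R + d%:R * k%:~R.
    apply: (mulIf (invr_neq0 d0)); rewrite -jt -kt.
    by rewrite mulrDl [X in _ = _ + X]mulrAC mulfV // mul1r.
  rewrite 3!pmulrn -intrM -intrD => /intr_inj ijk.
  have := congr1 (fun t => (t %% d)%Z) ijk.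
  rewrite addrC mulrC modzMDl !modz_nat => -[].
  by rewrite !modn_small.
move=> _ [_ [y Ey <-] <-]; have /intrP[m vy] := Ed y Ey.
have m_ge0 : 0 <= (m %% d)%Z by rewrite modz_ge0 // eqz_nat -lt0n.
have m_ltd : (m %% d)%Z < d by rewrite ltz_pmod // ltz_nat.
have mE := divz_eq m d.
case: (m %% d)%Z m_ge0 m_ltd mE => // i _; rewrite ltz_nat => id mE.
exists i => //; rewrite imE QvE.
have -> : v y = i%:R / d%:R + (m %/ d)%Z%:~R.
  apply: (mulfI d0); rewrite vy mulrDr mulrCA mulfV // mulr1 {1}mE.
  by rewrite intrD intrM mulrC addrC -pmulrn.
apply/seteqP; split=> _ [_ [k _ <-] <-] /=.
  exists (k - (m %/ d)%Z)%:~R; first by exists (k - (m %/ d)%Z).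
  by rewrite intrB; ring.
exists (k + (m %/ d)%Z)%:~R; first by exists (k + (m %/ d)%Z).
by rewrite intrD; ring.
Qed.

End UnitsOfQpF.

(** * Members of [F_tilde] as groups generated over F0~ by one element *)

Section FTilde.

Variables (p : nat) (p_pr : prime p) (D : falgType (padic p_pr)).
Variables (n : nat) (v : D -> rat).
Hypothesis n_gt0 : (0 < n)%N.
Hypothesis D_div : forall x : D, x != 0 -> x \is a GRing.unit.
Hypothesis vP : is_valuation n v.
Variable F : abelian_subgroup D.
Hypothesis F_fin : finite_set F.
Variables (u : padic_int p_pr) (u_unit : u \is a GRing.unit).
Implicit Types x y : D.

Local Notation E := (Qp_units F).
Local Notation Zu := (Zp_units F).
Local Notation Ft := (F0_tilde F u_unit).
Local Notation pu := (pu D u).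
Local Notation G x := (gen_subgroup (Ft `|` [set x])).

(** Everything lies in the commutative group of units of Q_p(F), so any product collects into an
    element of F0~ times a power of x. *)
Lemma gen_F_tildeP x y : absub_set E x ->
  G x y <-> exists w (k : int), Ft w /\ y = w * x ^ k.
Proof.
move=> Ex; have sFt := Ft_subgroup F u_unit; have sE := Qp_units_subgroup F.
have [ux Ft1] : x \is a GRing.unit /\ Ft 1 by split; [exact: absub_unit Ex|case: sFt].
split.
  move: y; apply: smallest_sub => [|y [Fty|->]] /=; last 2 first.
  - by exists y, 0; rewrite mulr1.
  - by exists 1, 1; rewrite mul1r.
  split=> [_ [w [k [Fw ->]]]||y z [w [k [Fw ->]]] [t [l [Fl ->]]]] /=.
  - apply: (@absub_unit _ E); apply: is_subgroupM => //; first exact: Ft_sub Fw.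
    exact: is_subgroupZ.
  - by exists 1, 0; rewrite mulr1.
  exists (w / t), (k - l); split; first by case: sFt => _ _; apply.
  have Et := Ft_sub Fl; have ut := absub_unit Et.
  rewrite invrM ?unitrXz // exprzDr // -invr_expz -!mulrA; congr (w * _).
  rewrite mulrA; apply: (@absubC _ E); last by exact: is_subgroupV.
  by apply: is_subgroupM => //; [|apply: is_subgroupV => //]; exact: is_subgroupZ.
move=> [w [k [Fw ->]]] M [sM sub]; apply: is_subgroupM => //; first by apply: sub; left.
by apply: is_subgroupZ => //; apply: sub; right.
Qed.

Lemma gen_F_tilde_subgroup x : absub_set E x -> is_subgroup (G x).
Proof.
move=> Ex; have sub : G x `<=` E.
  apply: smallest_sub; first exact: Qp_units_subgroup.
  by move=> y [/Ft_sub//|->].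
split=> [y /sub/absub_unit//||y z Gy Gz M [sM subM]].
  by move=> M [[]].
by case: (sM) => _ _; apply; [apply: Gy|apply: Gz].
Qed.

Lemma gen_F_tilde_mem r x : (0 < r)%N -> absub_set E x ->
  v x = r%:R^-1 -> Ft (x ^+ r) -> F_tilde v F u_unit n r (G x).
Proof.
move=> r_gt0 Ex vx Fxr; have sG := gen_F_tilde_subgroup Ex.
have r0 : (r%:R : rat) != 0 by rewrite pnatr_eq0 -lt0n.
have sFt := Ft_subgroup F u_unit; have x0 := absub_neq0 Ex.
have GE : G x `<=` E.
  apply: smallest_sub; first exact: Qp_units_subgroup.
  by move=> y [/Ft_sub//|->].
have FG : Ft `<=` G x by move=> y Fy M [_ sub]; apply: sub; left.
have Gx : G x x by move=> M [_ sub]; apply: sub; right.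
have vG y : G x y -> exists w k, [/\ Ft w, y = w * x ^ k & v y = v w + k%:~R / r%:R].
  move=> /(gen_F_tildeP _ Ex)[w [k [Fw ->]]]; exists w, k; split=> //.
  rewrite (valuationM vP) ?(vZ D_div vP) ?vx //; first exact: absub_neq0 (Ft_sub Fw).
  exact/unit_neq0/unitrXz/D_div.
have inj y z : G x y -> G x z -> v y - v z \is a Num.int -> Ft (y / z).
  move=> Gy Gz; have Gyz : G x (y / z) by case: sG => _ _; apply.
  rewrite -(v_div D_div vP) ?(absub_neq0 (GE _ Gy)) ?(absub_neq0 (GE _ Gz)) //.
  have [w [k [Fw -> ->]]] := vG _ Gyz.
  rewrite rpredDl; last exact: (v_Ft D_div vP F_fin Fw).
  (* An element w x^k of integral valuation has k = m r, so x^k is a power of x^r and lies in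
     F0~. *)
  move=> /intrP[m /(canRL (mulfVK r0))]; rewrite pmulrn -intrM => /intr_inj ->.
  apply: is_subgroupM => //; rewrite mulrC -exprz_exp.
  exact: is_subgroupZ.
split=> //.
  split=> [y /GE/absub_neq0|y|//]; first exact: (valuation_range vP).
  exact: (v_Ft D_div vP F_fin).
apply: (card_cosets D_div vP sG sFt FG r_gt0 Gx vx) => //.
- move=> y /vG[w [k [Fw _ ->]]]; rewrite mulrDr mulrCA mulfV // mulr1.
  by rewrite rpredD ?intr_int // rpredM ?natr_int // (v_Ft D_div vP F_fin Fw).
- exact: (v_Ft D_div vP F_fin).
- by move=> y z /GE Ey /GE Ez; exact: absubC Ey Ez.
Qed.

(** Injectivity modulo Z puts x^r, of valuation 1, into F0~, and likewise y / x^k for y in F1 and k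
    = r v(y). *)
Lemma F_tilde_eq_gen r F1 x : (0 < r)%N -> F_tilde v F u_unit n r F1 -> F1 x ->
  v x = r%:R^-1 -> (forall y, F1 y -> r%:R * v y \is a Num.int) ->
  Ft (x ^+ r) /\ F1 = G x.
Proof.
move=> r_gt0 [sF1 F1E FF1 [_ _ inj] _] F1x vx F1r.
have r0 : (r%:R : rat) != 0 by rewrite pnatr_eq0 -lt0n.
have Ex := F1E _ F1x; have x0 := absub_neq0 Ex.
have F11 : F1 1 by case: sF1.
have F1X (k : int) : F1 (x ^ k) by exact: is_subgroupZ.
split.
  rewrite -[x ^+ r]divr1; apply: inj => //; first exact: (F1X r).
  by rewrite (vX D_div vP) // vx mulfV // (v1 vP) subr0 rpred1.
apply/seteqP; split=> [y F1y|]; last first.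
  by apply: smallest_sub => // y [/FF1//|->].
apply/(gen_F_tildeP _ Ex); have /intrP[k yk] := F1r y F1y.
exists (y / x ^ k), k; split; last by rewrite mulrVK // unitrXz // (absub_unit Ex).
apply: inj => //; rewrite (vZ D_div vP) // vx -yk mulrAC mulfV // mul1r subrr.
exact: rpred0.
Qed.

(** The value group of F1 is (1/d)Z for some d, and counting cosets of F0~ shows d = r. *)
Lemma F_tilde_gen r F1 : (0 < r)%N -> F_tilde v F u_unit n r F1 ->
  (exists x, [/\ F1 x, absub_set E x, v x = r%:R^-1, Ft (x ^+ r) & F1 = G x]) /\
  forall y, F1 y -> r%:R * v y \is a Num.int.
Proof.
move=> r_gt0 FF1; have [sF1 F1E FtF1 [_ _ inj] F1r] := FF1.
have [d [x [d_gt0 F1x vx dF1]]] := value_group_cyclic n_gt0 D_div vP sF1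
  (FtF1 _ (Ft_pu F u_unit 1)) (v_puX D_div vP u_unit 1).
have vFt := v_Ft D_div vP F_fin.
have F1d : (cosets F1 Ft #= `I_d)%card.
  apply: (card_cosets D_div vP sF1 (Ft_subgroup F u_unit) FtF1 d_gt0 F1x vx dF1) => //.
    exact: vFt.
  by move=> y z /F1E Ey /F1E Ez; exact: absubC Ey Ez.
have dr : d = r.
  by apply/card_eq_II; apply: card_eq_trans F1r; rewrite card_eq_sym.
rewrite dr in dF1 vx; split=> //; exists x.
have [Fxr FG] := F_tilde_eq_gen r_gt0 FF1 F1x vx dF1.
by split=> //; exact: F1E.
Qed.

End FTilde.

(** * Cohomology classes *)

Section Cohomology.

Lemma coh_class_eq (A B C : zmodType) (d : {additive A -> B}) (d' : {additive B -> C})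
    (x y : cocycle d') :
  coh_class d x = coh_class d y <-> exists a, d a = cochain x - cochain y.
Proof.
rewrite /coh_class; split=> [/eqP|xy]; last apply/eqP; rewrite -Quotient.idealrBE.
  by move=> /asboolP.
exact/asboolP.
Qed.

Variables (G : finZmodType) (A : zmodType).

Lemma H2_class_eq0 (z : cocycle2 G A) :
  H2_class z = 0 <-> exists f, delta1 f = cochain z.
Proof.
have -> : (0 : H2 G A) = H2_class 0.
  by rewrite /H2_class /coh_class; exact: esym (raddf0 _).
by rewrite coh_class_eq subr0.
Qed.

(** The action is trivial, so [delta0] vanishes and a class contains a single cocycle. *)
Lemma H1_class_inj (x y : cocycle1 G A) : H1_class x = H1_class y -> cochain x = cochain y.
Proof.
move=> /coh_class_eq[a]; rewrite (_ : _ a = 0).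
  by move=> /esym/subr0_eq.
by apply/ffunP => g; rewrite !ffunE subrr.
Qed.

Lemma H1_class_surj (c : H1 G A) : exists x : cocycle1 G A, H1_class x = c.
Proof. by exists (repr c); exact: reprK. Qed.

(** As [H2_map] is computed on the representative chosen by [repr], the cochain bounding the
    difference with z is transported along h and q. *)
Lemma H2_map_class (G' : finZmodType) (A' : zmodType) (h : {additive G' -> G})
    (q : {additive A -> A'}) (z : cocycle2 G A) :
  H2_map h q (H2_class z) = H2_class (cocycle2_map h q z).
Proof.
apply/coh_class_eq.
have [f fE] : exists f, delta1 f = cochain (repr (H2_class z)) - cochain z.
  by apply/coh_class_eq; exact: reprK.
exists [ffun g => q (f (h g))]; apply/ffunP => -[g1 g2].
have /ffunP/(_ (h g1, h g2)) := fE; rewrite !ffunE /= => fE'.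
have := congr1 q fE'; rewrite raddfD !raddfB (raddfD h) => ->.
by [].
Qed.

End Cohomology.

Lemma inZp1_mulrn k m : (inZp 1 : 'I_k.+1) *+ m = inZp m.
Proof.
elim: m => [|m IH]; first by apply: val_inj; rewrite /= mod0n.
by apply: val_inj; rewrite mulrS IH /= modnDm add1n.
Qed.

Lemma quot_class_eq (R : unitRingType) (X Y : abelian_subgroup R) (x y : absub_elt X) :
  quot_class Y x = quot_class Y y <-> absub_set Y (elt_val (x - y)).
Proof.
split=> [/eqP|xy]; last apply/eqP; rewrite -Quotient.idealrBE.
  by move=> /asboolP.
exact/asboolP.
Qed.

Lemma quot_class_surj (R : unitRingType) (X Y : abelian_subgroup R)
  (c : absub_quot X Y) : exists x, quot_class Y x = c.
Proof. by exists (repr c); exact: reprK. Qed.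

Lemma elt_valX (R : unitRingType) (X : abelian_subgroup R) (x : absub_elt X) k :
  elt_val (x *+ k) = elt_val x ^+ k.
Proof. by elim: k => [|k IH]; rewrite ?mulr0n // mulrS exprS -IH. Qed.

(** Cocycle identity for s(g) + s(h) - s(g+h): here e, a, b are the values of s at g, h, k, and d,
    c, f those at g+h, h+k, g+h+k. *)
Lemma delta2_section (A : zmodType) (a b c d e f : A) :
  (a + b - c) - (d + b - f) + (e + c - f) - (e + a - d) = 0.
Proof.
rewrite -[LHS]addrA (addrBBA (a + b)) (addrBBA (e + c)).
have cancelr x y t : x + y - (t + y) = x - t :> A by rewrite opprD addrACA subrr addr0.
rewrite cancelr !(addrC e) cancelr addrDBA.
by rewrite (addrC (a - d)) !subrKA subrr.
Qed.

(** * The extension of Q_p(F) and its class *)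

Section ExtIncl.

Variables (p : nat) (p_pr : prime p) (D : falgType (padic p_pr)).
Variables (F : abelian_subgroup D) (u : padic_int p_pr) (u_unit : u \is a GRing.unit).

Lemma ext_incl_additive : zmod_morphism (@ext_incl _ _ D F u u_unit).
Proof.
have inclD a b : ext_incl (a + b) = ext_incl a + @ext_incl _ _ D F u u_unit b.
  apply: val_inj; rewrite /= -!mulrA; congr (_ * _); rewrite !mulrA; congr (_ * _).
  apply: (@absubC _ (Qp_units F)); first exact/Zp_units_sub/eltP.
  exact/(@pu_group_sub _ _ _ _ u_unit)/eltP.
by move=> a b; apply: (addIr (ext_incl b)); rewrite -inclD !subrK.
Qed.

HB.instance Definition _ :=
  GRing.isZmodMorphism.Build _ _ (@ext_incl _ _ D F u u_unit) ext_incl_additive.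

Lemma F_tilde_comm x y : F0_tilde F u_unit x -> F0_tilde F u_unit y -> x * y = y * x.
Proof. by move=> /Ft_sub Ex /Ft_sub Ey; exact: absubC Ex Ey. Qed.

(** In this form F0~ defines, through [sub_pred], an additive subgroup of the units of Q_p(F), in
    which congruences modulo F0~ are computed. *)
Definition F_tilde_group : abelian_subgroup D :=
  AbelianSubgroup (Ft_subgroup F u_unit) F_tilde_comm.

End ExtIncl.

Section ExtClass.

Variables (p : nat) (p_pr : prime p) (D : falgType (padic p_pr)).
Variables (n : nat) (v : D -> rat).
Hypothesis n_gt0 : (0 < n)%N.
Hypothesis D_div : forall x : D, x != 0 -> x \is a GRing.unit.
Hypothesis vP : is_valuation n v.
Variable F : abelian_subgroup D.
Hypothesis F_fin : finite_set F.
Variables (u : padic_int p_pr) (u_unit : u \is a GRing.unit).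

Local Notation E := (Qp_units F).
Local Notation Zu := (Zp_units F).
Local Notation P := (pu_group D u_unit).
Local Notation Ft := (F0_tilde F u_unit).
Local Notation pu := (pu D u).
Local Notation e := (ramification_index v F).
Local Notation incl := (@ext_incl _ _ D F u u_unit).
Local Notation proj := (@ext_proj _ _ D v F).
Local Notation S := (sub_pred (X := E) (F_tilde_group F u_unit)).
Implicit Types x y : absub_elt E.
Implicit Types a b : (absub_elt Zu * absub_elt P)%type.

Lemma elt_neq0 (X : abelian_subgroup D) (x : absub_elt X) : elt_val x != 0.
Proof. exact/absub_neq0/eltP. Qed.

Lemma v_elt_valB x y : v (elt_val (x - y)) = v (elt_val x) - v (elt_val y).
Proof. exact: (v_div D_div vP (elt_neq0 x) (elt_neq0 y)). Qed.

Lemma e_neq0 : (e%:R : rat) != 0.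
Proof.
have [e_gt0 _] := ramification_indexP n_gt0 D_div vP F u_unit.
by rewrite pnatr_eq0 -lt0n.
Qed.

Lemma ext_proj_int x (m : int) : e%:R * v (elt_val x) = m%:~R ->
  proj x = inZp 1 *~ m.
Proof. by rewrite /ext_proj => ->; rewrite intrKfloor. Qed.

Lemma ext_v_int x : exists m : int, e%:R * v (elt_val x) = m%:~R.
Proof.
have [_ [_ [_ _ Ee]]] := ramification_indexP n_gt0 D_div vP F u_unit.
exact/intrP/Ee/eltP.
Qed.

Lemma ext_proj_additive : zmod_morphism proj.
Proof.
move=> x y; have [[m xm] [k yk]] := (ext_v_int x, ext_v_int y).
rewrite (ext_proj_int xm) (ext_proj_int yk) -mulrzBr; apply: ext_proj_int.
by rewrite v_elt_valB mulrBr xm yk intrB.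
Qed.

Lemma ext_proj_eq0 x : proj x = 0 <-> v (elt_val x) \is a Num.int.
Proof.
have [m xm] := ext_v_int x; have [e_gt0 _] := ramification_indexP n_gt0 D_div vP F u_unit.
have eE : e.-1.+1 = e by rewrite prednK.
rewrite (ext_proj_int xm); split=> [m0|/intrP[k xk]].
  have : (e %| m)%Z.
    have {}m0 : (inZp 1 : 'I_e.-1.+1) *+ `|m|%N = 0.
      by case: m m0 {xm} => k; rewrite ?NegzE ?mulrNz => // /eqP; rewrite oppr_eq0 => /eqP.
    have := congr1 val m0; rewrite inZp1_mulrn /= eE => /eqP m0'.
    by rewrite dvdzE.
  move=> /dvdzP[k mk]; suff -> : v (elt_val x) = k%:~R by exact: intr_int.
  by apply: (mulfI e_neq0); rewrite xm mk intrM mulrC.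
have -> : m = e%:Z * k by apply: (@intr_inj rat); rewrite -xm xk intrM.
rewrite mulrzA -pmulrn inZp1_mulrn.
have -> : (inZp e : 'I_e.-1.+1) = 0 by apply: val_inj; rewrite /= eE modnn.
by rewrite mul0rz.
Qed.

Lemma ext_incl_v a : v (elt_val (incl a)) \is a Num.int.
Proof.
have [k [wk vk]] := pu_group_v D_div vP (eltP a.2).
rewrite /= (valuationM vP) ?elt_neq0 // vk (v_Zp_units D_div vP F_fin (eltP a.1)).
by rewrite add0r intr_int.
Qed.

(** Dividing x by (pu)^k for k = v(x) leaves an element of valuation 0, that is, a unit of
    Z_p(F). *)
Lemma ext_proj_ker x : proj x = 0 -> exists a, incl a = x.
Proof.
move=> /ext_proj_eq0/intrP[k xk].
have Ex := eltP x; have Epu := Qp_units_pu F u_unit (- k).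
have Zz : absub_set Zu (elt_val x * pu ^ (- k)).
  apply: (v0_Zp_units n_gt0 D_div vP F_fin); first exact: absubM.
  rewrite (valuationM vP) ?elt_neq0 ?(absub_neq0 Epu) // (v_puX D_div vP u_unit).
  by rewrite xk intrN subrr.
exists (AbsubElt (asboolT Zz), AbsubElt (asboolT (pu_group_pu D u_unit k))).
apply: val_inj; rewrite /= -mulrA -exprzDr ?pu_unit // addNr mulr1.
by [].
Qed.

(** The valuation recovers the exponent of pu. *)
Lemma ext_incl_inj : injective incl.
Proof.
move=> a b ab; apply/eqP; rewrite -subr_eq0; apply/eqP.
have {ab} := congr1 val (congr1 (fun t => t - incl b) ab).
rewrite subrr -raddfB; case: (a - b) => z w /= zw.
have [k [wk vk]] := pu_group_v D_div vP (eltP w).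
have := v1 vP; rewrite -zw (valuationM vP) ?elt_neq0 // vk.
rewrite (v_Zp_units D_div vP F_fin (eltP z)) add0r => /eqP; rewrite intr_eq0 => /eqP k0.
have w1 : elt_val w = 1 by rewrite wk k0.
by congr pair; apply: val_inj; move: zw; rewrite //= w1 mulr1.
Qed.

(** This turns vanishing of coefficients modulo F into membership in F0~, so that cochain identities
    can be checked in the units of Q_p(F). *)
Lemma coef_proj_eq0 a : coef_proj a = 0 <-> incl a \in S.
Proof.
rewrite /coef_proj; have -> : 0 = quot_class F (0 : absub_elt Zu) by rewrite raddf0.
rewrite quot_class_eq subr0; split=> [Fa|/asboolP Fa].
  by apply/asboolP; exists (elt_val a.1), (elt_val a.2); split=> //; exact: eltP.
have va := v_Zp_units D_div vP F_fin (eltP a.1).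
apply: (Ft_v0 D_div vP F_fin (u_unit := u_unit)) => //.
have [k [wk vk]] := pu_group_v D_div vP (eltP a.2).
have -> : elt_val a.1 = elt_val (incl a) / elt_val a.2.
  by rewrite /= mulrK // D_div // elt_neq0.
have [_ _] := Ft_subgroup F u_unit; apply=> //.
by rewrite wk; exact: Ft_pu.
Qed.

(** [ext_class] is selected by [xget] with default value 0, so a class must be shown to exist. The
    section is g -> x0^g with v(x0) = 1/e. *)
Lemma e_uP : exists (s : 'I_e.-1.+1 -> absub_elt E)
    (z : cocycle2 'I_e.-1.+1 (absub_elt Zu * absub_elt P)%type),
  [/\ forall g, proj (s g) = g,
      forall g h, incl (cochain z (g, h)) = s g + s h - s (g + h) &
      e_u v F u_unit = H2_class z].
Proof.
suff : [set c | is_ext_class incl proj c] (e_u v F u_unit) by [].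
apply: xgetPex.
have [e_gt0 [x0 [Ex0 vx0 _]]] := ramification_indexP n_gt0 D_div vP F u_unit.
have eE : e.-1.+1 = e by rewrite prednK.
pose xe : absub_elt E := AbsubElt (asboolT Ex0).
pose s (g : 'I_e.-1.+1) := xe *+ g.
have sP g : proj (s g) = g.
  rewrite (@ext_proj_int _ g) -?pmulrn ?inZp1_mulrn.
    by apply: val_inj; rewrite /= modn_small.
  by rewrite elt_valX (vX D_div vP) ?elt_neq0 // vx0 mulrCA mulfV ?e_neq0 // mulr1.
have ex_t (gh : 'I_e.-1.+1 * 'I_e.-1.+1) :
    exists t, incl t = s gh.1 + s gh.2 - s (gh.1 + gh.2).
  apply: ext_proj_ker; have projD x y : proj (x + y) = proj x + proj y.
    by apply: (addIr (- proj y)); rewrite addrK -ext_proj_additive addrK.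
  by rewrite ext_proj_additive projD !sP subrr.
have [t tP] := choice ex_t; pose f := [ffun gh => t gh].
(* The identity is verified after the injective map [incl]. *)
have f_cocycle : f \in cocycle_pred (@delta2 'I_e.-1.+1 (absub_elt Zu * absub_elt P)%type).
  apply/eqP/ffunP => -[[g h] k]; rewrite !ffunE; apply: ext_incl_inj.
  rewrite raddf0; transitivity
    (incl (t (h, k)) - incl (t (g + h, k)) + incl (t (g, h + k)) - incl (t (g, h))).
    by rewrite raddfB raddfD raddfB.
  by rewrite !tP /= (addrA g h k); exact: delta2_section.
exists (H2_class (Cocycle f_cocycle)), s, (Cocycle f_cocycle); split=> // g h.
by rewrite /= ffunE tP.
Qed.

Lemma e_u_image_eq0 r (re : (r %| e)%N) : (0 < r)%N ->
  e_u_image v F u_unit re = 0 <->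
  exists x : D, [/\ absub_set E x, v x = r%:R^-1 & Ft (x ^+ r)].
Proof.
move=> r_gt0; have [e_gt0 [x0 [Ex0 vx0 _]]] := ramification_indexP n_gt0 D_div vP F u_unit.
have [s [z [sP zP eE]]] := e_uP.
have eS : e.-1.+1 = e by rewrite prednK.
have rS : r.-1.+1 = r by rewrite prednK.
have r0 : (r%:R : rat) != 0 by rewrite pnatr_eq0 -lt0n.
have modE m : (m %% r.-1.+1 = m %% r)%N by rewrite rS.
set iota := cyc_incl re.
rewrite /e_u_image /e_u_res eE (H2_map_class _ _ z) H2_map_class H2_class_eq0 /=.
set c := cochain2_map _ _ _.
have cE g h : c (g, h) = coef_proj (cochain z (iota g, iota h)). by rewrite !ffunE.
have inclP g h : incl (cochain z (iota g, iota h)) = s (iota g) + s (iota h) - s (iota (g + h)).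
  have iotaD : iota (g + h) = iota g + iota h.
    exact: (raddfD (cyc_incl re : {additive _ -> _})).
  by rewrite zP iotaD.
have v_iota (x : absub_elt E) k : v (elt_val x) = r%:R^-1 -> proj (x *+ k) = inZp (k * (e %/ r)).
  move=> vx; rewrite (@ext_proj_int _ (k * (e %/ r))%N) -?pmulrn ?inZp1_mulrn //.
  rewrite elt_valX (vX D_div vP) ?elt_neq0 // vx -[in LHS](divnK re) !natrM.
  by rewrite mulrCA mulfK.
have iotaE k : iota (inZp k) = inZp (k * (e %/ r)).
  apply: val_inj; rewrite /= eS rS muln_modl.
  by rewrite [(r * _)%N]mulnC divnK // modn_mod.
split=> [[f fE]|[x [Ex vx Fx]]]; last first.
  pose xe : absub_elt E := @AbsubElt _ E x (asboolT Ex).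
  (* The section at g/r and x^g have the same valuation modulo Z, so their quotient comes from the
     kernel; its class modulo F is the trivializing cochain. *)
  have ex_t (g : 'I_r.-1.+1) : exists t, incl t = s (iota g) - xe *+ g.
    apply: ext_proj_ker; rewrite ext_proj_additive sP v_iota //.
    by rewrite -iotaE valZpK subrr.
  have [t tP] := choice ex_t.
  exists [ffun g => coef_proj (t g)]; apply/ffunP => -[g h].
  rewrite cE !ffunE; apply/eqP; rewrite -subr_eq0 -raddfB -raddfD -raddfB; apply/eqP.
  apply/coef_proj_eq0.
  rewrite [incl _](_ : _ = incl (t h) - incl (t (g + h)) + incl (t g) -
    incl (cochain z (iota g, iota h))); last by rewrite raddfB raddfD raddfB.
  rewrite !tP inclP addrBBA addrDBA.
  rewrite [X in X - _ - _]addrAC [s (iota h) + _]addrC addrAC subrr sub0r rpredN.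
  (* What remains is the carry of g + h modulo r: a power of x^r, hence an element of F0~. *)
  rewrite addrAC -mulrnDr [(h + g)%N]addnC [(g + h)%N](divn_eq _ r).
  rewrite mulrnDr /= modE addrK mulnC mulrnA; apply: rpredMn.
  by apply/asboolP; rewrite elt_valX.
have [y yP] := choice (fun g => quot_class_surj (f g)).
(* The section corrected by lifts of the trivializing cochain is a homomorphism modulo F0~. *)
pose sg g := s (iota g) - incl (y g, 0).
have sgS g h : sg g + sg h - sg (g + h) \in S.
  have -> : sg g + sg h - sg (g + h) =
      incl (cochain z (iota g, iota h) - ((y g, 0) + (y h, 0) - (y (g + h), 0))).
    transitivity (incl (cochain z (iota g, iota h)) -
        (incl (y g, 0) + incl (y h, 0) - incl (y (g + h), 0))).
      by rewrite inclP /sg addrDBA addrBBA.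
    have inclD a b : incl (a + b) = incl a + incl b by exact: raddfD.
    by rewrite !ext_incl_additive inclD.
  have projD a b : coef_proj (a + b) = coef_proj a + @coef_proj _ _ D F u u_unit b.
    exact: raddfD.
  apply/coef_proj_eq0; rewrite coef_proj_additive -cE -fE !ffunE.
  rewrite coef_proj_additive projD /coef_proj /= !yP.
  by rewrite [f h - _ + _]addrAC [f h + _]addrC subrr.
have sg0 : sg 0 \in S by have := sgS 0 0; rewrite addr0 addrK.
have sgX k : sg (inZp 1) *+ k - sg (inZp k) \in S.
  elim: k => [|k IH].
    have -> : inZp 0 = 0 :> 'I_r.-1.+1 by apply: val_inj; rewrite /= mod0n.
    by rewrite mulr0n sub0r rpredN.
  rewrite -(inZp1_mulrn _ k.+1) mulrS [_ *+ k.+1]mulrS inZp1_mulrn.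
  rewrite -[sg (inZp 1) *+ k](subrK (sg (inZp k))) addrCA -addrA.
  exact: rpredD.
(* Modulo F0~, r times [sg] at 1 is [sg] at r = 0 in Z/r, which is trivial. *)
have sgr : sg (inZp 1) *+ r \in S.
  rewrite -[_ *+ r](subrK (sg 0)); apply: rpredD => //.
  have -> : 0 = inZp r :> 'I_r.-1.+1 by apply: val_inj; rewrite /= rS modnn.
  exact: sgX.
pose xe : absub_elt E := AbsubElt (asboolT Ex0).
(* The element x0^(e/r) has valuation exactly 1/r and serves to compare: the valuation of [sg] at 1
   differs from it by an integer k. *)
have vxe : v (elt_val (xe *+ (e %/ r))) = r%:R^-1.
  rewrite elt_valX (vX D_div vP) ?elt_neq0 // vx0 -[X in _ / X%:R](divnK re) natrM.
  rewrite invfM mulrA mulfV ?mul1r // pnatr_eq0 -lt0n divn_gt0 //.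
  exact: dvdn_leq.
have /ext_proj_eq0/intrP[k vk] : proj (sg (inZp 1) - xe *+ (e %/ r)) = 0.
  rewrite ext_proj_additive -[_ *+ (e %/ r)]mulr1n v_iota // mul1n.
  rewrite ext_proj_additive sP iotaE mul1n (proj2 (ext_proj_eq0 _)) ?subr0 ?subrr //.
  exact: ext_incl_v.
move: vk; rewrite v_elt_valB vxe => /eqP; rewrite subr_eq => /eqP vk.
have Esg := eltP (sg (inZp 1)); have Epu := Qp_units_pu F u_unit (- k).
(* The factor (pu)^(-k) makes the valuation exactly 1/r and keeps the r-th power in F0~. *)
exists (elt_val (sg (inZp 1)) * pu ^ (- k)); split; first exact: (absubM Esg Epu).
  rewrite (valuationM vP) ?elt_neq0 ?(absub_neq0 Epu) // (v_puX D_div vP u_unit).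
  by rewrite vk intrN addrAC subrr add0r.
rewrite exprMn_comm; last exact: absubC Esg Epu.
have FtM := is_subgroupM (Ft_subgroup F u_unit).
apply: FtM; first by have /asboolP := sgr; rewrite elt_valX.
by rewrite exprnP exprz_exp; exact: Ft_pu.
Qed.

End ExtClass.

Lemma quot_class0 (R : unitRingType) (X Y : abelian_subgroup R) :
  quot_class Y (0 : absub_elt X) = 0.
Proof. exact: raddf0. Qed.

Lemma quot_classMn (R : unitRingType) (X Y : abelian_subgroup R) (x : absub_elt X) k :
  quot_class Y (x *+ k) = quot_class Y x *+ k.
Proof. exact: raddfMn. Qed.

(** * Homomorphisms from a cyclic group as 1-cocycles *)

Section CyclicCocycles.

Variables (r : nat) (A : zmodType).
Hypothesis r_gt0 : (0 < r)%N.

Lemma mulrn_modr (a : A) m : a *+ r = 0 -> a *+ (m %% r) = a *+ m.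
Proof. by move=> ar; rewrite [in RHS](divn_eq m r) mulrnDr mulnC mulrnA ar mul0rn add0r. Qed.

(** For the trivial action a 1-cocycle is a homomorphism. *)
Lemma cocycle1_inZp (f : cocycle1 'I_r.-1.+1 A) m :
  cochain f (inZp m) = cochain f (inZp 1) *+ m.
Proof.
have fD g h : cochain f (g + h) = cochain f g + cochain f h.
  case: f => f /= /eqP/ffunP/(_ (g, h)); rewrite !ffunE => /eqP.
  by rewrite addrAC subr_eq0 addrC => /eqP.
elim: m => [|m IH]; last by rewrite -(inZp1_mulrn _ m.+1) mulrS fD inZp1_mulrn IH mulrS.
apply: (addrI (cochain f (inZp 0))); rewrite -fD addr0; congr (cochain f _).
by apply: val_inj; rewrite /= mod0n.
Qed.

Lemma cocycle1_exp (f : cocycle1 'I_r.-1.+1 A) : cochain f (inZp 1) *+ r = 0.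
Proof.
rewrite -cocycle1_inZp -[RHS](mulr0n (cochain f (inZp 1))) -cocycle1_inZp.
by congr (cochain f _); apply: val_inj; rewrite /= prednK // modnn mod0n.
Qed.

Lemma cocycle1_eq (f g : cocycle1 'I_r.-1.+1 A) :
  cochain f (inZp 1) = cochain g (inZp 1) -> f = g.
Proof.
move=> fg; apply: val_inj; apply/ffunP => i.
by rewrite -[i]valZpK (cocycle1_inZp f) (cocycle1_inZp g) fg.
Qed.

Lemma cocycle1_of (a : A) : a *+ r = 0 ->
  exists f : cocycle1 'I_r.-1.+1 A, cochain f (inZp 1) = a.
Proof.
move=> ar; pose f : {ffun 'I_r.-1.+1 -> A} := [ffun g => a *+ val g].
have modE m : (m %% r.-1.+1 = m %% r)%N by rewrite prednK.
have fP : f \in cocycle_pred (@delta1 'I_r.-1.+1 A).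
  apply/eqP/ffunP => -[g h]; rewrite !ffunE /= modE.
  by rewrite mulrn_modr // addrAC -mulrnDr addnC subrr.
(* For r = 1 the generator [inZp 1] is 0; [mulrn_modr] covers this case, where a = 0. *)
by exists (Cocycle fP); rewrite /= ffunE /= modE mulrn_modr.
Qed.

End CyclicCocycles.

(** * The criterion and the bijection *)

Theorem theorem2p16 (p : nat) (p_pr : prime p) (n : nat)
    (D : falgType (padic p_pr)) (v : D -> rat) (O : set D)
    (u : padic_int p_pr) (u_unit : u \is a GRing.unit)
    (F0 : abelian_subgroup D) (r1 : nat)
    (r1_dvd : (r1 %| ramification_index v F0)%N) :
  (0 < n)%N -> (p.-1 %| n)%N ->
  is_Dn n v -> is_maximal_order O ->
  finite_set F0 -> F0 `<=` unit_group O ->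
  (F_tilde v F0 u_unit n r1 !=set0 <-> e_u_image v F0 u_unit r1_dvd = 0)
  /\
  (forall (F1 : set D) (x1 : D),
     F_tilde v F0 u_unit n r1 F1 ->
     F1 = gen_subgroup (F0_tilde F0 u_unit `|` [set x1]) ->
     v x1 = r1%:R^-1 ->
     exists psi : H1 'I_r1.-1.+1 (absub_quot (Zp_units F0) F0) -> set D,
       (forall (f : cocycle1 'I_r1.-1.+1 (absub_quot (Zp_units F0) F0))
               (y : absub_elt (Zp_units F0)),
          quot_class F0 y = cochain f (inZp 1) ->
          psi (H1_class f) =
            gen_subgroup (F0_tilde F0 u_unit `|` [set elt_val y * x1])) /\
       set_bij setT (F_tilde v F0 u_unit n r1) psi).
Proof.
move=> n_gt0 _ [D_div _ _ vP _] _ F_fin _.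
have [e_gt0 _] := ramification_indexP n_gt0 D_div vP F0 u_unit.
have r_gt0 : (0 < r1)%N by exact: dvdn_gt0 r1_dvd.
split.
  rewrite (e_u_image_eq0 n_gt0 D_div vP F_fin u_unit r1_dvd r_gt0).
  split=> [[F1 /(F_tilde_gen n_gt0 D_div vP F_fin r_gt0)[[x [_ Ex vx Fx _]] _]]|].
    by exists x.
  move=> [x [Ex vx Fx]]; eexists.
  exact: (gen_F_tilde_mem D_div vP F_fin r_gt0 Ex vx Fx).
move=> F1 x1 FF1 F1E vx1.
have F1x1 : F1 x1 by rewrite F1E => M [_ sub]; apply: sub; right.
have Ex1 : absub_set (Qp_units F0) x1 by case: FF1 => _ sub _ _ _; exact: sub.
have [_ F1r] := F_tilde_gen n_gt0 D_div vP F_fin r_gt0 FF1.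
have [Fx1 _] := F_tilde_eq_gen D_div vP r_gt0 FF1 F1x1 vx1 F1r.
have x10 := absub_neq0 Ex1; have ux1 := absub_unit Ex1.
pose G x := gen_subgroup (F0_tilde F0 u_unit `|` [set x]).
have ZE (y : absub_elt (Zp_units F0)) : absub_set (Qp_units F0) (elt_val y).
  exact/Zp_units_sub/eltP.
have vyx (y : absub_elt (Zp_units F0)) : v (elt_val y * x1) = r1%:R^-1.
  rewrite (valuationM vP) ?elt_neq0 // vx1.
  by rewrite (v_Zp_units D_div vP F_fin (eltP y)) add0r.
have divE (y z : absub_elt (Zp_units F0)) : elt_val y * x1 / (elt_val z * x1) = elt_val (y - z).
  rewrite invrM ?(absub_unit (ZE z)) // mulrA mulrK //.
(* The group depends only on y modulo F: y x1 is z x1 times y / z, and y / z lies in F. *)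
have G_sub (y z : absub_elt (Zp_units F0)) :
    quot_class F0 y = quot_class F0 z -> G (elt_val y * x1) `<=` G (elt_val z * x1).
  move=> /quot_class_eq Fyz; have Ez := absubM (ZE z) Ex1.
  apply: smallest_sub; first exact: gen_F_tilde_subgroup.
  move=> w [Fw M [_ sub]|->]; first by apply: sub; left.
  apply/(gen_F_tildeP u_unit _ Ez); exists (elt_val (y - z)), 1; split.
    exact: F_sub_Ft.
  by rewrite -divE expr1z mulrVK // (absub_unit Ez).
have G_eq (y z : absub_elt (Zp_units F0)) :
    quot_class F0 y = quot_class F0 z -> G (elt_val y * x1) = G (elt_val z * x1).
  by move=> yz; apply/seteqP; split; apply: G_sub.
(* The class of y is killed by r1, so (y x1)^r1 = y^r1 x1^r1 is a product of an element of F0 and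
   one of F0~. *)
have G_mem (f : cocycle1 'I_r1.-1.+1 (absub_quot (Zp_units F0) F0)) y :
    quot_class F0 y = cochain f (inZp 1) -> F_tilde v F0 u_unit n r1 (G (elt_val y * x1)).
  move=> yf; apply: (gen_F_tilde_mem D_div vP F_fin r_gt0 (absubM (ZE y) Ex1) (vyx y)).
  rewrite exprMn_comm; last exact: absubC (ZE y) Ex1.
  apply: (is_subgroupM (Ft_subgroup F0 u_unit)) => //.
  apply: F_sub_Ft; rewrite -elt_valX -[y *+ r1]subr0; apply/quot_class_eq.
  by rewrite quot_classMn yf cocycle1_exp // quot_class0.
have lift (f : cocycle1 'I_r1.-1.+1 (absub_quot (Zp_units F0) F0)) :=
  quot_class_surj (cochain f (inZp 1)).
(* The value of psi is fixed by a property of all cocycles in the class and all lifts y at once, so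
   it does not depend on these choices. *)
have psi_ex (c : H1 'I_r1.-1.+1 (absub_quot (Zp_units F0) F0)) : exists X, forall f y, H1_class f = c ->
    quot_class F0 y = cochain f (inZp 1) -> X = G (elt_val y * x1).
  have [f fc] := H1_class_surj c; have [y yf] := lift f.
  exists (G (elt_val y * x1)) => g z gc zg; apply: G_eq.
  by rewrite yf zg (H1_class_inj (etrans fc (esym gc))).
have [psi psiP] := choice psi_ex.
have psiE (f : cocycle1 'I_r1.-1.+1 (absub_quot (Zp_units F0) F0)) y :
  quot_class F0 y = cochain f (inZp 1) -> psi (H1_class f) = G (elt_val y * x1).
  exact: psiP.
exists psi; split=> //; split=> [c _|c d _ _|F2 FF2] /=.
- have [f <-] := H1_class_surj c; have [y yf] := lift f.
  by rewrite (psiE f y) //; exact: G_mem yf.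
(* Injectivity: y x1 and z x1 lie in one member and have equal valuation, so y / z lies in F0~ and,
   having valuation 0, in F0. *)
- have [f <-] := H1_class_surj c; have [y yf] := lift f.
  have [g <-] := H1_class_surj d; have [z zg] := lift g.
  rewrite (psiE f y) // (psiE g z) // => Gyz.
  congr H1_class; apply: cocycle1_eq; rewrite -yf -zg; apply/quot_class_eq.
  have [_ _ _ [_ _ inj] _] := G_mem g z zg.
  apply: (Ft_v0 D_div vP F_fin (u_unit := u_unit)); last first.
    by rewrite -divE (v_div D_div vP) ?(absub_neq0 (absubM (ZE _) Ex1)) // !vyx subrr.
  rewrite -divE; apply: inj; last by rewrite !vyx subrr rpred0.
    by rewrite -Gyz => M [_ sub]; apply: sub; right.
  by move=> M [_ sub]; apply: sub; right.
have [[x2 [F2x2 Ex2 vx2 Fx2 ->]] _] := F_tilde_gen n_gt0 D_div vP F_fin r_gt0 FF2.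
have x20 := absub_neq0 Ex2.
(* Surjectivity: y = x2 / x1 has valuation 0, and y^r1 lies in F0~ with valuation 0, hence in F0; so
   the class of y defines a homomorphism. *)
have Zy : absub_set (Zp_units F0) (x2 / x1).
  apply: (v0_Zp_units n_gt0 D_div vP F_fin); first exact: absub_div.
  by rewrite (v_div D_div vP) // vx1 vx2 subrr.
pose y : absub_elt (Zp_units F0) := AbsubElt (asboolT Zy).
have yr : quot_class F0 y *+ r1 = 0.
  rewrite -quot_classMn -(quot_class0 _ F0); apply/quot_class_eq; rewrite subr0.
  apply: (Ft_v0 D_div vP F_fin (u_unit := u_unit)); last first.
    exact: (v_Zp_units D_div vP F_fin (eltP _)).
  rewrite elt_valX /= exprMn_comm; last exact: absubC Ex2 (absubV Ex1).
  by rewrite exprVn; case: (Ft_subgroup F0 u_unit) => _ _; apply.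
have [f fy] := cocycle1_of r_gt0 yr.
exists (H1_class f) => //.
by rewrite (psiE f y (esym fy)) /= mulrVK.
Qed.
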